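(* Let $M$ be an aspherical topological space with countable amenable residually finite fundamental group and let $n \in \mathbb{N}$. Then there is a constant $K \in \mathbb{R}_{>0}$ such that: if $c \in C_n(M;\mathbb{Z})$ is a null-homologous cycle, then there is a sequence $(b_k)_{k \in \mathbb{N}}$ of chains and a sequence $(M_k)_{k \in \mathbb{N}}$ of covering spaces of $M$ with the following properties: (1) For each $k \in \mathbb{N}$, there is a regular finite-sheeted covering $p_k \colon M_k \to M$ of $M$, and the covering degrees $d_k$ satisfy $\lim_{k \to \infty} d_k = \infty$. (2) For each $k \in \mathbb{N}$ we have $b_k \in C_{n+1}(M_k;\mathbb{Z})$ and \[ \partial b_k = c_k \quad\text{and}\quad |b_k|_1 \leq d_k \cdot K \cdot |c|_1, \] where $c_k \in C_n(M_k;\mathbb{Z})$ denotes the full $p_k$-lift of $c$.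
   Context: A topological space is called aspherical if it is path-connected, locally path-connected and admits a contractible universal covering. $C_*(\,\cdot\,;\mathbb{Z})$ is the integral singular chain complex, and $|\cdot|_1$ is the $\ell^1$-norm: $\bigl|\sum_{j=1}^m a_j \sigma_j\bigr|_1 = \sum_{j=1}^m |a_j|$ for pairwise distinct singular simplices $\sigma_j$. A cycle is null-homologous if it is a boundary. If $p_k\colon M_k \to M$ is a finite-sheeted covering and $c = \sum_{j=1}^m a_j \cdot \sigma_j \in C_n(M;\mathbb{Z})$, the full $p_k$-lift of $c$ is \[ c_k = \sum_{j=1}^m a_j \cdot \Bigl( \sum_{\tau \in \mathrm{map}(\Delta^n, M_k),\ p_k \circ \tau = \sigma_j} \tau \Bigr) \in C_n(M_k;\mathbb{Z}), \] where $\mathrm{map}(\Delta^n,M_k)$ is the set of singular $n$-simplices of $M_k$. *)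

(* Defs.v *)
From HB Require Import structures.
From mathcomp Require Import all_boot all_order all_algebra fingroup.
From mathcomp Require Import generic_quotient.
From mathcomp Require Import all_classical all_reals topology normedtype homotopy.
From mathcomp.multinomials Require Import freeg.
From mathcomp Require Import lra.

Set Implicit Arguments.
Unset Strict Implicit.
Unset Printing Implicit Defensive.

Import Order.TTheory GRing.Theory Num.Theory numFieldNormedType.Exports.

Local Open Scope classical_set_scope.
Local Open Scope ring_scope.

Section UnitInterval.
Variable R : realType.

Definition unit_interval : Type := set_type (`[0, 1]%classic : set R).

HB.instance Definition _ := Topological.on unit_interval.

Lemma clamp_subproof (t : R) :
  Num.max 0 (Num.min t 1) \in (`[0, 1]%classic : set R).
Proof.
by rewrite mem_setE in_itv /= le_max lexx /= ge_max ler01 /= ge_min lexx orbT.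
Qed.

Definition clamp (t : R) : unit_interval := SigSub (clamp_subproof t).

Definition ival (s : unit_interval) : R := val s.

Lemma ival_ge0 (s : unit_interval) : 0 <= ival s.
Proof. by case: s => t /=; rewrite /ival /= mem_setE in_itv /= => /andP[]. Qed.

Lemma ival_le1 (s : unit_interval) : ival s <= 1.
Proof. by case: s => t /=; rewrite /ival /= mem_setE in_itv /= => /andP[]. Qed.

Lemma ival_inj : injective ival. Proof. exact: val_inj. Qed.

Lemma ival_clamp (t : R) : ival (clamp t) = Num.max 0 (Num.min t 1).
Proof. by []. Qed.

Lemma clampK (t : R) : 0 <= t -> t <= 1 -> ival (clamp t) = t.
Proof. by move=> t0 t1; rewrite ival_clamp (min_idPl t1) (max_idPr t0). Qed.

Lemma ivalK : cancel ival clamp.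
Proof.
by move=> s; apply: ival_inj; rewrite clampK ?ival_ge0 ?ival_le1.
Qed.

Lemma clamp01_neq : clamp 0 != clamp 1.
Proof.
apply/eqP => /(congr1 ival); rewrite !clampK ?lexx ?ler01 // => /esym/eqP.
by rewrite oner_eq0.
Qed.

HB.instance Definition _ := isBiPointed.Build unit_interval clamp01_neq.

Lemma ival0 : ival zero = 0. Proof. by rewrite clampK ?lexx ?ler01. Qed.

Lemma ival1 : ival one = 1. Proof. by rewrite clampK ?lexx ?ler01. Qed.

Lemma ival_continuous : continuous ival.
Proof. exact: initial_continuous. Qed.

Lemma clamp_continuous : continuous clamp.
Proof.
apply: continuous_comp_initial => t.
apply: (@continuous_max R R (cst 0) (fun u : R => Num.min u 1)).
  exact: cvg_cst.
apply: (@continuous_min R R idfun (cst 1)); [exact: cvg_id | exact: cvg_cst].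
Qed.

End UnitInterval.

Section Continuity.
Variable R : realType.
Local Notation I := (unit_interval R).

Lemma contC (X Y Z : topologicalType) (f : X -> Y) (g : Y -> Z) :
  continuous g -> continuous f -> continuous (fun x => g (f x)).
Proof. by move=> cg cf x; apply: (continuous_comp (cf x) (cg (f x))). Qed.

Lemma contP (X Y Z : topologicalType) (f : X -> Y) (g : X -> Z) :
  continuous f -> continuous g -> continuous (fun x => (f x, g x)).
Proof. by move=> cf cg x; exact: (cvg_pair (cf x) (cg x)). Qed.

Lemma cont_fst (X Y : topologicalType) : continuous (@fst X Y).
Proof. by move=> x; exact: cvg_fst. Qed.

Lemma cont_snd (X Y : topologicalType) : continuous (@snd X Y).
Proof. by move=> x; exact: cvg_snd. Qed.

Lemma cont_id (X : topologicalType) : continuous (fun x : X => x).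
Proof. by move=> x; exact: cvg_id. Qed.

Lemma cont_cst (X Y : topologicalType) (y : Y) : continuous (fun _ : X => y).
Proof. by move=> x; exact: cvg_cst. Qed.

Section RealValued.
Variable X : topologicalType.
Implicit Types f g : X -> R.

Lemma contD f g : continuous f -> continuous g ->
  continuous (fun x => f x + g x).
Proof. by move=> cf cg x; exact: (@cvgD _ R^o _ _ _ f g _ _ (cf x) (cg x)). Qed.

Lemma contN f : continuous f -> continuous (fun x => - f x).
Proof. by move=> cf x; exact: (@cvgN _ R^o _ _ _ f _ (cf x)). Qed.

Lemma contM f g : continuous f -> continuous g ->
  continuous (fun x => f x * g x).
Proof. by move=> cf cg x; exact: (cvgM (cf x) (cg x)). Qed.

Lemma cont_min f g : continuous f -> continuous g ->
  continuous (fun x => Num.min (f x) (g x)).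
Proof.
by move=> cf cg x; exact: (@continuous_min R X f g x (cf x) (cg x)).
Qed.

Lemma cont_norm f : continuous f -> continuous (fun x => `|f x|).
Proof. by move=> cf x; exact: (cvg_norm (cf x)). Qed.

End RealValued.

Lemma paste_continuous (X Y : topologicalType) (u : Y -> R) (a : R)
    (f g : Y -> X) : continuous u -> continuous f -> continuous g ->
    (forall y, u y = a -> f y = g y) ->
  continuous (fun y => if u y <= a then f y else g y).
Proof.
move=> cu cf cg fg y U /=; case: (ltgtP (u y) a) => uya nU.
- have nL : nbhs y (u @^-1` [set r | r < a]) by apply: (cu y); exact: lt_nbhsl.
  by apply: filterS2 nL (cf y U nU) => z /= /ltW ->.
- have nL : nbhs y (u @^-1` [set r | a < r]) by apply: (cu y); exact: lt_nbhsr.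
  by apply: filterS2 nL (cg y U nU) => z /= az; rewrite leNgt az.
- have nU' := nU; rewrite (fg y uya) in nU'.
  have nf : nbhs y (f @^-1` U) by exact: (cf y U nU).
  by apply: filterS2 nf (cg y U nU') => z /= Uf Ug; case: ifP.
Qed.

Lemma cont_path (X Y : topologicalType) (x y : X) (p : {path I from x to y})
  (f : Y -> I) : continuous f -> continuous (fun z => p (f z)).
Proof. by apply: contC; exact: cts_fun. Qed.

End Continuity.

Ltac cont := lazymatch goal with
  | |- continuous (fun u => u) => exact: cont_id
  | |- continuous fst => exact: cont_fst
  | |- continuous snd => exact: cont_snd
  | |- continuous (@ival _) => exact: ival_continuous
  | |- continuous (@clamp _) => exact: clamp_continuous
  | |- continuous (fun _ => ?c) => exact: cont_cst
  | |- continuous (fun _ => (_, _)) => refine (contP _ _); cont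
  | |- continuous (fun _ => _.1) => refine (contC (@cont_fst _ _) _); cont
  | |- continuous (fun _ => _.2) => refine (contC (@cont_snd _ _) _); cont
  | |- continuous (fun _ => ival _) =>
      refine (contC (@ival_continuous _) _); cont
  | |- continuous (fun _ => clamp _) =>
      refine (contC (@clamp_continuous _) _); cont
  | |- continuous (fun _ => _ + _) => refine (contD _ _); cont
  | |- continuous (fun _ => - _) => refine (contN _); cont
  | |- continuous (fun _ => _ * _) => refine (contM _ _); cont
  | |- continuous (fun _ => Num.min _ _) => refine (cont_min _ _); cont
  | |- continuous (fun _ => `|_|) => refine (cont_norm _); cont
  | h : continuous ?H |- continuous (fun _ => ?H _) => refine (contC h _); cont
  | |- _ => refine (cont_path _); cont
  end.

Section Homotopy.
Variables (R : realType) (X : topologicalType).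
Local Notation I := (unit_interval R).
Implicit Types x y z : X.

Definition homotopic x y (p q : {path I from x to y}) : Prop :=
  exists H : I * I -> X, [/\ continuous H,
    forall s, H (s, zero) = p s, forall s, H (s, one) = q s,
    forall t, H (zero, t) = x & forall t, H (one, t) = y].

Lemma homotopic_refl x y (p : {path I from x to y}) : homotopic p p.
Proof.
exists (fun st => p st.1); split => //=.
- by cont.
- by move=> _; rewrite path_zero.
- by move=> _; rewrite path_one.
Qed.

Lemma homotopic_sym x y (p q : {path I from x to y}) :
  homotopic p q -> homotopic q p.
Proof.
move=> [H [cH H0 H1 Hx Hy]].
exists (fun st => H (st.1, clamp (1 - ival st.2))); split; rewrite //.
- by cont.
- by move=> s; rewrite ival0 subr0 H1.
- by move=> s; rewrite ival1 subrr H0.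
Qed.

Lemma homotopic_trans x y (p q r : {path I from x to y}) :
  homotopic p q -> homotopic q r -> homotopic p r.
Proof.
move=> [H [cH H0 H1 Hx Hy]] [K [cK K0 K1 Kx Ky]].
exists (fun st => if ival st.2 <= 2^-1 then H (st.1, clamp (2 * ival st.2))
                  else K (st.1, clamp (2 * ival st.2 - 1))); split.
- apply: paste_continuous; [by cont..|].
  move=> [s t] /= ->; rewrite divff ?pnatr_eq0 // subrr.
  by rewrite (H1 s) (K0 s).
- by move=> s; rewrite ival0 invr_ge0 ler0n mulr0 H0.
- move=> s; rewrite ival1 leNgt invf_lt1 ?ltr0n ?ltr1n //= mulr1.
  by rewrite (_ : 2 - 1 = 1 :> R) ?K1 //; lra.
- by move=> t; case: ifP => _; rewrite ?Hx ?Kx.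
- by move=> t; case: ifP => _; rewrite ?Hy ?Ky.
Qed.

Section Concat.
Variables (x y z : X) (p : {path I from x to y}) (q : {path I from y to z}).

Definition concat_fun (s : I) : X :=
  if ival s <= 2^-1 then p (clamp (2 * ival s)) else q (clamp (2 * ival s - 1)).

Lemma concat_continuous : continuous concat_fun.
Proof.
apply: paste_continuous; [by cont..|].
by move=> s /= ->; rewrite divff ?pnatr_eq0 // subrr path_one path_zero.
Qed.

Lemma concat_zero : concat_fun zero = x.
Proof. by rewrite /concat_fun ival0 invr_ge0 ler0n mulr0 path_zero. Qed.

Lemma concat_one : concat_fun one = z.
Proof.
rewrite /concat_fun ival1 leNgt invf_lt1 ?ltr0n ?ltr1n //= mulr1.
by rewrite (_ : 2 - 1 = 1 :> R) ?path_one //; lra.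
Qed.

Definition concat : {path I from x to z} :=
  mk_path concat_continuous concat_zero concat_one.

Lemma concatl (t : R) : 0 <= t -> t <= 2^-1 ->
  concat (clamp t) = p (clamp (2 * t)).
Proof.
move=> t0 t1; rewrite /concat /= /mk_path /concat_fun clampK ?t1 //.
by apply: (le_trans t1); lra.
Qed.

Lemma concatr (t : R) : 2^-1 < t -> t <= 1 ->
  concat (clamp t) = q (clamp (2 * t - 1)).
Proof.
move=> t0 t1; rewrite /concat /= /mk_path /concat_fun clampK //; last first.
  by apply: (le_trans _ (ltW t0)); lra.
by rewrite leNgt t0.
Qed.

End Concat.

Section Reverse.
Variables (x y : X) (p : {path I from x to y}).

Definition reverse_fun (s : I) : X := p (clamp (1 - ival s)).

Lemma reverse_continuous : continuous reverse_fun.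
Proof. by rewrite /reverse_fun; cont. Qed.

Lemma reverse_zero : reverse_fun zero = y.
Proof. by rewrite /reverse_fun ival0 subr0 path_one. Qed.

Lemma reverse_one : reverse_fun one = x.
Proof. by rewrite /reverse_fun ival1 subrr path_zero. Qed.

Definition reverse : {path I from y to x} :=
  mk_path reverse_continuous reverse_zero reverse_one.

End Reverse.

Lemma homotopic_concat x y z (p p' : {path I from x to y})
    (q q' : {path I from y to z}) :
  homotopic p p' -> homotopic q q' -> homotopic (concat p q) (concat p' q').
Proof.
move=> [H [cH H0 H1 Hx Hy]] [K [cK K0 K1 Kx Ky]].
exists (fun st => if ival st.1 <= 2^-1 then H (clamp (2 * ival st.1), st.2)
                  else K (clamp (2 * ival st.1 - 1), st.2)); split.
- apply: paste_continuous; [by cont..|].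
  move=> [s t] /= ->; rewrite divff ?pnatr_eq0 // subrr.
  by rewrite (Hy t) (Kx t).
- by move=> s; rewrite H0 K0.
- by move=> s; rewrite H1 K1.
- by move=> t; rewrite ival0 invr_ge0 ler0n mulr0 Hx.
- move=> t; rewrite ival1 leNgt invf_lt1 ?ltr0n ?ltr1n //= mulr1.
  by rewrite (_ : 2 - 1 = 1 :> R) ?Ky //; lra.
Qed.

Lemma homotopic_reverse x y (p p' : {path I from x to y}) :
  homotopic p p' -> homotopic (reverse p) (reverse p').
Proof.
move=> [H [cH H0 H1 Hx Hy]].
exists (fun st => H (clamp (1 - ival st.1), st.2)); split.
- by cont.
- by move=> s; rewrite H0.
- by move=> s; rewrite H1.
- by move=> t; rewrite ival0 subr0 Hy.
- by move=> t; rewrite ival1 subrr Hx.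
Qed.

Lemma homotopic_reparam x y (p q : {path I from x to y}) (g : I -> X)
    (phi psi : I -> R) : continuous g -> continuous phi -> continuous psi ->
    phi zero = psi zero -> phi one = psi one ->
    (forall s, p s = g (clamp (phi s))) ->
    (forall s, q s = g (clamp (psi s))) ->
  homotopic p q.
Proof.
move=> cg cphi cpsi e0 e1 pE qE.
exists (fun st => g (clamp ((1 - ival st.2) * phi st.1
                            + ival st.2 * psi st.1))); split.
- by cont.
- by move=> s; rewrite ival0 subr0 mul1r mul0r addr0 pE.
- by move=> s; rewrite ival1 subrr mul1r mul0r add0r qE.
- move=> t; rewrite -e0 -mulrDl subrK mul1r -pE; exact: path_zero.
- move=> t; rewrite -e1 -mulrDl subrK mul1r -pE; exact: path_one.
Qed.

Lemma concatA x y z w (p : {path I from x to y}) (q : {path I from y to z})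
    (r : {path I from z to w}) :
  homotopic (concat p (concat q r)) (concat (concat p q) r).
Proof.
pose psi (s : I) := Num.min (2 * ival s)
  (Num.min (ival s + 4^-1) (2^-1 * (ival s + 1))).
apply: (@homotopic_reparam x w _ _ (concat p (concat q r)) (@ival R) psi).
- exact: cts_fun.
- by cont.
- by rewrite /psi; cont.
- by rewrite /psi ival0 mulr0; apply/esym/min_idPl; rewrite le_min; lra.
- rewrite /psi ival1 (min_r (_ : 2^-1 * (1 + 1) <= 1 + 4^-1)); last by lra.
  by rewrite min_r; lra.
- by move=> s; rewrite ivalK.
- move=> s; rewrite -{1}(ivalK s) /psi.
  move: (ival_ge0 s) (ival_le1 s); set t := ival s => t0 t1.
  have [t2|t2] := leP t 2^-1.
    rewrite concatl // (@min_l _ _ (t + 4^-1)); last by lra.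
    have [t4|t4] := leP t 4^-1.
      rewrite concatl; [|lra..].
      by rewrite min_l ?concatl //; lra.
    rewrite concatr; [|lra..].
    rewrite min_r; last by lra.
    rewrite concatr; [|lra..].
    by rewrite concatl; [congr (q (clamp _)); lra|lra..].
  rewrite concatr // (@min_r _ _ (t + 4^-1)); last by lra.
  rewrite min_r; last by lra.
  rewrite concatr; [|lra..].
  by rewrite concatr; [congr (r (clamp _)); lra|lra..].
Qed.

Definition cst_path x : {path I from x to x} := cst x.

Lemma concat1p x y (p : {path I from x to y}) :
  homotopic (concat (cst_path x) p) p.
Proof.
pose phi (s : I) := Num.max 0 (2 * ival s - 1).
have phiE s : phi s = - Num.min 0 (- (2 * ival s - 1)).
  by rewrite oppr_min oppr0 opprK.
apply: (@homotopic_reparam x y _ _ p phi (@ival R)).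
- exact: cts_fun.
- by rewrite (funext phiE); cont.
- by cont.
- by rewrite /phi ival0 mulr0; apply/max_l; lra.
- by rewrite /phi ival1 max_r; lra.
- move=> s; rewrite -{1}(ivalK s) /phi.
  move: (ival_ge0 s) (ival_le1 s); set t := ival s => t0 t1.
  have [t2|t2] := leP t 2^-1.
    by rewrite concatl // max_l ?path_zero //; lra.
  by rewrite concatr // max_r //; lra.
- by move=> s; rewrite ivalK.
Qed.

Lemma concatp1 x y (p : {path I from x to y}) :
  homotopic (concat p (cst_path y)) p.
Proof.
pose phi (s : I) := Num.min 1 (2 * ival s).
apply: (@homotopic_reparam x y _ _ p phi (@ival R)).
- exact: cts_fun.
- by rewrite /phi; cont.
- by cont.
- by rewrite /phi ival0 mulr0; apply/min_r; lra.
- by rewrite /phi ival1 min_l; lra.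
- move=> s; rewrite -{1}(ivalK s) /phi.
  move: (ival_ge0 s) (ival_le1 s); set t := ival s => t0 t1.
  have [t2|t2] := leP t 2^-1.
    by rewrite concatl // min_r //; lra.
  by rewrite concatr // min_l ?path_one //; lra.
- by move=> s; rewrite ivalK.
Qed.

Lemma concatpV x y (p : {path I from x to y}) :
  homotopic (concat p (reverse p)) (cst_path x).
Proof.
pose phi (s : I) := 1 - `|2 * ival s - 1|.
apply: (@homotopic_reparam x x _ _ p phi (fun=> 0)).
- exact: cts_fun.
- by rewrite /phi; cont.
- by cont.
- by rewrite /phi ival0 mulr0 sub0r normrN1 subrr.
- by rewrite /phi ival1 ger0_norm; lra.
- move=> s; rewrite -{1}(ivalK s) /phi.
  move: (ival_ge0 s) (ival_le1 s); set t := ival s => t0 t1.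
  have [t2|t2] := leP t 2^-1.
    by rewrite concatl // ler0_norm; [congr (p (clamp _)); lra|lra].
  rewrite concatr // ger0_norm; last by lra.
  by rewrite /reverse /= /mk_path /reverse_fun clampK //; lra.
- by move=> s; rewrite path_zero.
Qed.

Lemma concatVp x y (p : {path I from x to y}) :
  homotopic (concat (reverse p) p) (cst_path y).
Proof.
pose phi (s : I) := `|2 * ival s - 1|.
apply: (@homotopic_reparam y y _ _ p phi (fun=> 1)).
- exact: cts_fun.
- by rewrite /phi; cont.
- by cont.
- by rewrite /phi ival0 mulr0 sub0r normrN1.
- by rewrite /phi ival1 ger0_norm; lra.
- move=> s; rewrite -{1}(ivalK s) /phi.
  move: (ival_ge0 s) (ival_le1 s); set t := ival s => t0 t1.
  have [t2|t2] := leP t 2^-1.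
    rewrite concatl // ler0_norm; last by lra.
    rewrite /reverse /= /mk_path /reverse_fun clampK; [|lra..].
    by congr (p (clamp _)); lra.
  by rewrite concatr // ger0_norm //; lra.
- by move=> s; rewrite path_one.
Qed.

End Homotopy.

Section FundamentalGroup.
Variables (R : realType) (X : topologicalType) (x : X).
Local Notation I := (unit_interval R).
Local Notation loop := {path I from x to x}.
Local Open Scope quotient_scope.

Definition loop_equiv : rel loop := fun p q => `[< homotopic p q >].

Lemma loop_equiv_refl : reflexive loop_equiv.
Proof. by move=> p; apply/asboolP; exact: homotopic_refl. Qed.

Lemma loop_equiv_sym : symmetric loop_equiv.
Proof. by move=> p q; apply/asboolP/asboolP; exact: homotopic_sym. Qed.

Lemma loop_equiv_trans : transitive loop_equiv.
Proof.
by move=> q p r /asboolP pq /asboolP qr; apply/asboolP/(homotopic_trans pq).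
Qed.

Canonical loop_equiv_rel :=
  EquivRel loop_equiv loop_equiv_refl loop_equiv_sym loop_equiv_trans.

Definition pi1 : Type := {eq_quot loop_equiv}.

HB.instance Definition _ := Choice.on pi1.
HB.instance Definition _ := EqQuotient.on pi1.

Definition pi1_class (p : loop) : pi1 := \pi_pi1 p.

Lemma pi1_classP (p q : loop) : pi1_class p = pi1_class q <-> homotopic p q.
Proof.
split=> [/eqmodP/asboolP//|pq]; apply/eqmodP/asboolP; exact: pq.
Qed.

Lemma pi1_classK (a : pi1) : pi1_class (repr a) = a.
Proof. exact: reprK. Qed.

Lemma repr_pi1_class (p : loop) : homotopic (repr (pi1_class p)) p.
Proof. by apply/pi1_classP; rewrite pi1_classK. Qed.

Definition pi1_one : pi1 := pi1_class (cst_path R x).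
Definition pi1_mul (a b : pi1) : pi1 := pi1_class (concat (repr a) (repr b)).
Definition pi1_inv (a : pi1) : pi1 := pi1_class (reverse (repr a)).

Lemma pi1_mulE (p q : loop) :
  pi1_mul (pi1_class p) (pi1_class q) = pi1_class (concat p q).
Proof.
by apply/pi1_classP/homotopic_concat; exact: repr_pi1_class.
Qed.

Lemma pi1_invE (p : loop) : pi1_inv (pi1_class p) = pi1_class (reverse p).
Proof. by apply/pi1_classP/homotopic_reverse; exact: repr_pi1_class. Qed.

Lemma pi1_mulA : associative pi1_mul.
Proof.
move=> a b c; rewrite -(pi1_classK a) -(pi1_classK b) -(pi1_classK c).
by rewrite !pi1_mulE; apply/pi1_classP; exact: concatA.
Qed.

Lemma pi1_mul1g : left_id pi1_one pi1_mul.
Proof.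
move=> a; rewrite -(pi1_classK a) pi1_mulE; apply/pi1_classP; exact: concat1p.
Qed.

Lemma pi1_mulg1 : right_id pi1_one pi1_mul.
Proof.
move=> a; rewrite -(pi1_classK a) pi1_mulE; apply/pi1_classP; exact: concatp1.
Qed.

Lemma pi1_mulVg : left_inverse pi1_one pi1_inv pi1_mul.
Proof.
move=> a; rewrite -(pi1_classK a) pi1_invE pi1_mulE; apply/pi1_classP.
exact: concatVp.
Qed.

Lemma pi1_mulgV : right_inverse pi1_one pi1_inv pi1_mul.
Proof.
move=> a; rewrite -(pi1_classK a) pi1_invE pi1_mulE; apply/pi1_classP.
exact: concatpV.
Qed.

HB.instance Definition _ :=
  isGroup.Build pi1
    pi1_mulA pi1_mul1g pi1_mulg1 pi1_mulVg pi1_mulgV.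

End FundamentalGroup.

Arguments pi1 R {X} x.

Section Groups.
Local Open Scope group_scope.

(* [m] is only constrained on bounded functions, i.e. it is a mean on
   l^oo(G, R). *)
Definition left_invariant_mean (R : realType) (G : groupType)
    (m : (G -> R) -> R) : Prop :=
  [/\ forall f g : G -> R^o, bounded_fun f -> bounded_fun g ->
        m (fun x => f x + g x)%R = (m f + m g)%R,
      forall (a : R) (f : G -> R^o), bounded_fun f ->
        m (fun x => a * f x)%R = (a * m f)%R,
      forall f : G -> R^o, bounded_fun f -> (forall x, 0 <= f x)%R ->
        (0 <= m f)%R,
      m (fun=> 1%R) = 1%R &
      forall (g : G) (f : G -> R^o), bounded_fun f ->
        m (fun x => f (g^-1 * x)) = m f].

Definition amenable (R : realType) (G : groupType) : Prop :=
  exists m : (G -> R) -> R, left_invariant_mean m.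

Definition residually_finite (G : groupType) : Prop :=
  forall g : G, g <> 1 ->
    exists (H : finGroupType) (f : {multiplicative G -> H}), f g <> 1.

End Groups.

Section Coverings.
Variables E M : topologicalType.
Implicit Type p : E -> M.

Definition homeomorphism_on p (A : set E) (U : set M) : Prop :=
  exists q : M -> E, [/\ set_bij A U p, {in A, cancel p q},
    {within A, continuous p} & {within U, continuous q}].

Definition evenly_covered p (U : set M) : Prop :=
  exists V : set (set E), [/\ forall A, V A -> open A,
    trivIset V id,
    p @^-1` U = \bigcup_(A in V) A &
    forall A, V A -> homeomorphism_on p A U].

(* Surjectivity is imposed separately: evenly covered sets may have an empty
   preimage. *)
Definition covering p : Prop :=
  [/\ continuous p, set_surj setT setT p &
    forall x : M, exists2 U, open_nbhs x U & evenly_covered p U].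

Definition deck_transformation p (h : E -> E) : Prop :=
  [/\ continuous h, p \o h = p &
    exists h' : E -> E, [/\ continuous h', cancel h h' & cancel h' h]].

(* The total space is not required to be connected. *)
Definition regular_covering p : Prop :=
  covering p /\
  forall e e' : E, p e = p e' -> exists2 h, deck_transformation p h & h e = e'.

Definition covering_degree p (d : nat) : Prop :=
  forall x : M, (p @^-1` [set x] #= `I_d)%card.

End Coverings.

Section Aspherical.
Variable R : realType.
Local Notation I := (unit_interval R).

Definition path_connected_set (X : topologicalType) (A : set X) : Prop :=
  A !=set0 /\ forall x y, A x -> A y ->
    exists p : {path I from x to y}, forall t, A (p t).

Definition path_connected (X : topologicalType) : Prop :=
  path_connected_set [set: X].

Definition locally_path_connected (X : topologicalType) : Prop :=
  forall (x : X) (U : set X), nbhs x U ->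
    exists V, [/\ open_nbhs x V, V `<=` U & path_connected_set V].

Definition simply_connected (X : topologicalType) : Prop :=
  path_connected X /\ forall (x : X) (a : pi1 R x), a = 1%g.

Definition contractible (X : topologicalType) : Prop :=
  exists (x : X) (H : X * I -> X), [/\ continuous H,
    forall y, H (y, zero) = y & forall y, H (y, one) = x].

Definition aspherical (X : topologicalType) : Prop :=
  [/\ path_connected X, locally_path_connected X &
    exists (E : topologicalType) (q : E -> X),
      [/\ covering q, simply_connected E & contractible E]].

End Aspherical.

Section SingularChains.
Variable R : realType.

Definition stdsimplex_set (n : nat) : set 'rV[R]_n.+1 :=
  [set t | (forall i, 0 <= t ord0 i) /\ \sum_i t ord0 i = 1].

Arguments stdsimplex_set : clear implicits.

Definition stdsimplex (n : nat) : Type := set_type (stdsimplex_set n).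

HB.instance Definition _ n := Topological.on (stdsimplex n).

Definition coords (n : nat) (t : stdsimplex n) : 'rV[R]_n.+1 := val t.

Lemma coords_continuous (n : nat) : continuous (@coords n).
Proof. exact: initial_continuous. Qed.

Section Face.
Variables (n : nat) (i : 'I_n.+2).

Definition face_row (t : 'rV[R]_n.+1) : 'rV[R]_n.+2 :=
  \row_j (if unlift i j is Some k then t ord0 k else 0).

Lemma face_subproof (t : stdsimplex n) :
  face_row (coords t) \in stdsimplex_set n.+1.
Proof.
have [t0 t1] : stdsimplex_set n (coords t) by exact: (set_mem (valP t)).
apply/mem_set; split=> [j|].
  by rewrite mxE; case: unlift.
rewrite (bigD1 i) //= mxE unlift_none add0r -[RHS]t1.
rewrite (reindex_omap (fintype.lift i) (unlift i)) /=; last first.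
  by move=> j; case: unliftP => [k ->//|->]; rewrite eqxx.
apply: eq_big => [k|k _]; first by rewrite liftK eqxx eq_sym neq_lift.
by rewrite mxE liftK.
Qed.

Definition face_fun (t : stdsimplex n) : stdsimplex n.+1 :=
  SigSub (face_subproof t).

Lemma face_row_continuous : continuous face_row.
Proof.
move=> t U [P nP PU].
exists (fun _ k => P ord0 (fintype.lift i k)).
  by move=> a k; have := nP ord0 (fintype.lift i k); rewrite [a]ord1 mxE liftK.
move=> t' /= Pt'; apply: PU => a b; rewrite [a]ord1.
case: (unliftP i b) => [k ->|->]; first by rewrite mxE liftK.
by have /nbhs_singleton := nP ord0 i; rewrite !mxE unlift_none.
Qed.

Lemma face_continuous : continuous face_fun.
Proof.
apply: continuous_comp_initial.
exact: (contC face_row_continuous (@coords_continuous n)).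
Qed.

(* The inclusion of the i-th face: it inserts a zero barycentric coordinate in
   position i. *)
Definition face : continuousType (stdsimplex n) (stdsimplex n.+1) :=
  mkcts face_continuous.

End Face.

Definition singular_simplex (n : nat) (X : topologicalType) : Type :=
  continuousType (stdsimplex n) X.

HB.instance Definition _ n X := Choice.on (singular_simplex n X).

Definition chain (n : nat) (X : topologicalType) : Type :=
  {freeg (singular_simplex n X) / int}.

HB.instance Definition _ n X := GRing.Lmodule.on (chain n X).

Variable X : topologicalType.

(* In degree 0 every chain is a cycle. *)
Definition boundary (n : nat) : chain n.+1 X -> chain n X :=
  fglift (fun sigma : singular_simplex n.+1 X =>
    \sum_(i < n.+2)
      (-1 : int) ^+ i *: << (sigma \o face i : singular_simplex n X) >>).

Definition is_cycle (n : nat) : chain n X -> Prop :=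
  match n with
  | 0 => fun=> True
  | m.+1 => fun c => boundary c = 0
  end.

Definition null_homologous (n : nat) (c : chain n X) : Prop :=
  exists b : chain n.+1 X, boundary b = c.

Definition l1norm (n : nat) (c : chain n X) : int :=
  \sum_(sigma <- dom c) `|coeff sigma c|.

End SingularChains.

Arguments face {R n} i.

(* A sum over an infinite set is 0 here; the set of lifts of a simplex is finite
   when the covering is finite-sheeted. *)
Definition full_lift (R : realType) (E M : topologicalType)
    (p : continuousType E M) (n : nat) : chain R n M -> chain R n E :=
  fglift (fun sigma : singular_simplex R n M =>
    \sum_(tau \in [set tau : singular_simplex R n E |
                   p \o tau = sigma :> (stdsimplex R n -> M)])
      (<< tau >> : chain R n E)).

(* Main.v *)
Require Import Defs.
From HB Require Import structures.
From mathcomp Require Import all_boot all_order all_algebra all_fingroup.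
From mathcomp Require Import all_classical all_reals topology normedtype.
From mathcomp Require Import homotopy.
From mathcomp.multinomials Require Import freeg.
From mathcomp Require Import zify lra.

Set Implicit Arguments.
Unset Strict Implicit.
Unset Printing Implicit Defensive.

Import Order.TTheory GRing.Theory Num.Theory numFieldNormedType.Exports.

Local Open Scope classical_set_scope.
Local Open Scope ring_scope.

(** Let [G] be the fundamental group of [M], acting on the contractible
    universal covering [E] by deck transformations. A homomorphism [phi]
    from [G] to a finite group [Q] gives a covering of [M] of degree
    [#|Q|], the quotient [assoc] of [E * Q] by [G], which comes with maps
    [i_y : E -> assoc] for [y] in [Q]. If a chain [c'] of [E] lies over
    [c], then the full lift of [c] is the sum over [y] of the images
    [i_y c'] ([full_lift_push]).

    Suppose that [c] is the boundary of [b], and take for [c'] the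
    boundary of a lift of [b]. The cone over [c'] given by the contraction
    of [E] has boundary [c'] ([cone_boundary]), so the images of this cone
    under the [i_y] fill the full lift. Their norm is at most [#|Q|] times
    the norm of [c'], but the latter is not controlled by the norm of [c]:
    simplices of [c'] that differ by a deck transformation may cancel in
    [M]. In other words [c'] is the sum of a lift of [c], simplex by
    simplex, and of finitely many differences [s - g s], with [s] a
    simplex of [E] and [g] in [G].

    To make these differences cheap, use the relation
    [i_(phi g * y) (g e) = i_y e]. Translating [c'] by an element [f y] of
    [G] before coning does not change the boundary of the filling. With
    these translations the filling of [s - g s] has norm at most twice the
    number of [y] in [Q] for which [f ((phi g)^-1 * y)] differs from
    [f y * g] ([fgl1_filling_diff]). So it suffices to find, for finitely
    many [g] and a given [eps], arbitrarily large finite quotients [Q] and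
    functions [f : Q -> G] such that this number is at most [eps * #|Q|]
    ([quasi_section]). For small [eps] the differences then contribute at
    most [#|Q|] to the norm of the filling. Since a nonzero integral chain
    has norm at least 1, the constant [K = 2] works.

    For [quasi_section], amenability yields a finite set [F] in [G] that
    is almost invariant under right translation by the given elements
    ([folner]), and residual finiteness yields a quotient [Q] in which [F]
    and its translates embed. Choose a linear order on [Q] uniformly at
    random, and let [f y] be the element [h] of [F] for which [phi h * y]
    comes first. Two points [y] and [(phi g)^-1 * y] have almost the same
    candidates [phi h * y], hence with high probability the same first
    candidate, and then [f ((phi g)^-1 * y) = f y * g]
    ([ex_quasi_section]). *)

(** * The l1-norm on finitely supported functions *)

Section FreeL1.
Variables (R : numDomainType) (K : choiceType).
Implicit Types D : {freeg K / R}.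

(** With integral coefficients on singular simplices this is [l1norm];
    real coefficients occur in the proof that amenability gives almost
    invariant sets. *)
Definition fgl1 D : R := \sum_(x <- dom D) `|coeff x D|.

Lemma fgl1_ge0 D : 0 <= fgl1 D.
Proof. by apply: sumr_ge0. Qed.

Lemma fgl1_sub D (s : seq K) : uniq s -> {subset dom D <= s} ->
  fgl1 D = \sum_(x <- s) `|coeff x D|.
Proof.
move=> us sub; rewrite (bigID (mem (dom D))) /= [X in _ + X]big1 ?addr0.
  rewrite -big_filter; apply: perm_big; apply: uniq_perm.
  - exact: uniq_dom.
  - exact: filter_uniq.
  - by move=> x; rewrite mem_filter /=; case: (boolP (x \in dom D)) => //= /sub.
by move=> x; rewrite mem_dom negbK => /eqP ->; rewrite normr0.
Qed.

Lemma fgl1_ge D (s : seq K) : uniq s ->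
  \sum_(x <- s) `|coeff x D| <= fgl1 D.
Proof.
move=> us; pose t := [seq x <- dom D | x \notin s].
rewrite (@fgl1_sub D (s ++ t)).
- by rewrite big_cat /= lerDl sumr_ge0.
- rewrite cat_uniq us filter_uniq ?uniq_dom // andbT /=.
  by apply/hasPn => x; rewrite mem_filter => /andP[].
- by move=> x xD; rewrite mem_cat mem_filter xD andbT orbN.
Qed.

Lemma fgl1_common D1 D2 : exists s : seq K,
  [/\ uniq s, {subset dom D1 <= s}, {subset dom D2 <= s} &
      {subset dom (D1 + D2) <= s}].
Proof.
exists (undup (dom D1 ++ dom D2)); split => [|x|x|x].
- exact: undup_uniq.
- by rewrite mem_undup mem_cat => ->.
- by rewrite mem_undup mem_cat orbC => ->.
- by move/domD_subset; rewrite mem_undup.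
Qed.

Lemma fgl1D_eq D1 D2 :
  (forall x, `|coeff x D1 + coeff x D2| = `|coeff x D1| + `|coeff x D2|) ->
  fgl1 (D1 + D2) = fgl1 D1 + fgl1 D2.
Proof.
move=> h; have [s [us s1 s2 s12]] := fgl1_common D1 D2.
rewrite !(fgl1_sub us) // -big_split /=; apply: eq_bigr => x _.
by rewrite coeffD h.
Qed.

Lemma fgl1D D1 D2 : fgl1 (D1 + D2) <= fgl1 D1 + fgl1 D2.
Proof.
have [s [us s1 s2 s12]] := fgl1_common D1 D2.
rewrite !(fgl1_sub us) // -big_split /=; apply: ler_sum => x _.
by rewrite coeffD ler_normD.
Qed.

Lemma fgl1_0 : fgl1 0 = 0.
Proof. by rewrite /fgl1 dom0 big_nil. Qed.

Lemma fgl1_eq0 D : (fgl1 D == 0) = (D == 0).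
Proof.
apply/idP/eqP => [|->]; last by rewrite fgl1_0.
rewrite psumr_eq0 => [/allP h|//]; apply/eqP/freeg_eqP => x; rewrite coeff0.
have [/h|] := boolP (x \in dom D); first by rewrite normr_eq0 => /eqP.
by rewrite mem_dom negbK => /eqP.
Qed.

Lemma fgl1Z k D : fgl1 (k *: D) = `|k| * fgl1 D.
Proof.
rewrite (@fgl1_sub _ (dom D)) ?uniq_dom //; last exact: domZ_subset.
by rewrite mulr_sumr; apply: eq_bigr => x _; rewrite coeffZ normrM.
Qed.

Lemma fgl1N D : fgl1 (- D) = fgl1 D.
Proof. by rewrite -scaleN1r fgl1Z normrN1 mul1r. Qed.

Lemma fgl1B D1 D2 : fgl1 (D1 - D2) <= fgl1 D1 + fgl1 D2.
Proof. by rewrite -[fgl1 D2]fgl1N; exact: fgl1D. Qed.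

Lemma fgl1U x : fgl1 << x >> = 1.
Proof. by rewrite /fgl1 domU1 big_seq1 coeffU eqxx mulr1 normr1. Qed.

Lemma fgl1_sum (I : Type) (r : seq I) (P : pred I) (F : I -> {freeg K / R}) :
  fgl1 (\sum_(i <- r | P i) F i) <= \sum_(i <- r | P i) fgl1 (F i).
Proof.
elim/big_ind2: _ => [|D1 n1 D2 n2 h1 h2|//]; first by rewrite fgl1_0.
by apply: le_trans (fgl1D _ _) _; exact: lerD.
Qed.

Lemma fgU_scale k x : << k *g x >> = k *: << x >> :> {freeg K / R}.
Proof.
by apply/eqP/freeg_eqP => y; rewrite coeffZ !coeffU mul1r.
Qed.

Section Lift.
Variables (V : lmodType R) (f : K -> V).

Lemma fgliftD D1 D2 : fglift f (D1 + D2) = fglift f D1 + fglift f D2.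
Proof.
have add := lift_is_additive f; have l0 : fglift f 0 = 0.
  by have := add 0 0; rewrite !subrr.
have lN D : fglift f (- D) = - fglift f D by have := add 0 D; rewrite l0 !sub0r.
by rewrite -{1}[D2]opprK add lN opprK.
Qed.

Lemma fglift0 : fglift f 0 = 0.
Proof. by apply: (addrI (fglift f 0)); rewrite -fgliftD !addr0. Qed.

Lemma fglift_sum (I : Type) (r : seq I) (P : pred I) (F : I -> {freeg K / R}) :
  fglift f (\sum_(i <- r | P i) F i) = \sum_(i <- r | P i) fglift f (F i).
Proof. exact: (big_morph _ fgliftD fglift0). Qed.

Lemma fgliftZ k D : fglift f (k *: D) = k *: fglift f D.
Proof.
rewrite -[D]freeg_sumE scaler_sumr !fglift_sum scaler_sumr.
apply: eq_bigr => x _; rewrite liftU fgU_scale scalerA -fgU_scale liftU.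
by rewrite scalerA.
Qed.

Lemma fgliftB D1 D2 : fglift f (D1 - D2) = fglift f D1 - fglift f D2.
Proof. by rewrite fgliftD -[- D2]scaleN1r fgliftZ scaleN1r. Qed.

Lemma fglift1 x : fglift f << x >> = f x.
Proof. by rewrite liftU scale1r. Qed.

Lemma fgliftE D : fglift f D = \sum_(x <- dom D) coeff x D *: f x.
Proof.
rewrite -{1}[D]freeg_sumE fglift_sum; apply: eq_bigr => x _; exact: liftU.
Qed.

End Lift.

End FreeL1.

Section FreeL1Lift.
Variables (R : numDomainType) (K L : choiceType).

Lemma fgl1_fglift (f : K -> {freeg L / R}) (c : R) (D : {freeg K / R}) :
  (forall x, fgl1 (f x) <= c) -> fgl1 (fglift f D) <= c * fgl1 D.
Proof.
move=> fc; rewrite fgliftE mulr_sumr; apply: le_trans (fgl1_sum _ _ _) _.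
apply: ler_sum => x _; rewrite fgl1Z mulrC; exact: ler_wpM2r.
Qed.

Lemma fglift_eq (V : lmodType R) (f g : K -> V) (D : {freeg K / R}) :
  f =1 g -> fglift f D = fglift g D.
Proof. by move=> /funext ->. Qed.

Lemma fglift_comp (V : lmodType R) (f : K -> {freeg L / R}) (g : L -> V) D :
  fglift g (fglift f D) = fglift (fun x => fglift g (f x)) D.
Proof.
rewrite [in RHS]fgliftE [fglift f D]fgliftE fglift_sum.
by apply: eq_bigr => x _; rewrite fgliftZ.
Qed.

Lemma fglift_id (D : {freeg K / R}) : fglift (fun x => << x >>) D = D.
Proof.
rewrite fgliftE -[RHS]freeg_sumE.
by apply: eq_bigr => x _; rewrite [RHS]fgU_scale.
Qed.

End FreeL1Lift.

(** * Additive functionals below a sublinear functional *)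

Section HahnBanach.
Variables (R : realType) (X : lmodType R).
Implicit Types (p q : X -> R) (u v : X) (t : R).

Definition sublinear p :=
  (forall u v, p (u + v) <= p u + p v) /\
  (forall t u, 0 <= t -> p (t *: u) = t * p u).

Lemma sublinear0 p : sublinear p -> p 0 = 0.
Proof. by move=> [_ hom]; rewrite -(scale0r 0) hom // mul0r. Qed.

Lemma sublinear_ge p u : sublinear p -> - p (- u) <= p u.
Proof.
move=> sp; have := sp.1 u (- u); rewrite subrr sublinear0 //; lra.
Qed.

(** Zorn's lemma applies because the pointwise infimum of a chain of
    sublinear functionals is sublinear; it is finite since every sublinear
    functional below [p] is bounded below by [- p (- u)] at [u]. *)
Lemma sublinear_minimal p : sublinear p -> exists q,
  [/\ sublinear q, (forall u, q u <= p u) &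
      forall q', sublinear q' -> (forall u, q' u <= q u) -> q' = q].
Proof.
move=> sp; pose T := {q | sublinear q /\ forall u, q u <= p u}.
pose S (q q' : T) := `[< forall u, sval q' u <= sval q u >].
have [||[q hq] [q' hq'] /asboolP h /asboolP h'|C Ctot|[q [sq qp]] qmin] :=
  @Zorn T S.
- by move=> q; apply/asboolP.
- move=> q r s /asboolP qr /asboolP rs; apply/asboolP => u.
  exact: le_trans (rs u) (qr u).
- by apply/eq_exist/funext => u; apply/eqP; rewrite eq_le h' h.
- have [[q0 Cq0]|C0] := pselect (exists q : T, C q); last first.
    by exists (exist _ p (conj sp (fun=> lexx _))) => q Cq; case: C0; exists q.
  pose V u := [set sval (q : T) u | q in C].
  have Vlb u : lbound (V u) (- p (- u)).
    move=> _ [[q [sq qp]] _ <-] /=; apply: le_trans (sublinear_ge u sq).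
    by rewrite lerN2.
  have Vinf u : has_inf (V u).
    by split; [exists (sval q0 u), q0|exists (- p (- u))].
  have infV (q : T) u : C q -> inf (V u) <= sval q u.
    by move=> Cq; apply: ge_inf; [exists (- p (- u))|exists q].
  have Vne u : V u !=set0 by exists (sval q0 u), q0.
  have si : sublinear (fun u => inf (V u)).
    split=> [u v|t u].
      suff h (q q' : T) : C q -> C q' ->
          inf (V (u + v)) <= sval q u + sval q' v.
        rewrite -lerBlDr; apply: lb_le_inf => // _ [q Cq <-].
        rewrite lerBlDr -lerBlDl; apply: lb_le_inf => // _ [q' Cq' <-].
        by rewrite lerBlDl; exact: h.
      move=> Cq Cq'; have [/asboolP h|/asboolP h] := Ctot _ _ Cq Cq'.
        apply: le_trans (infV _ _ Cq') _.
        by apply: le_trans ((svalP q').1.1 u v) _; rewrite lerD2r; exact: h.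
      apply: le_trans (infV _ _ Cq) _.
      by apply: le_trans ((svalP q).1.1 u v) _; rewrite lerD2l; exact: h.
    rewrite le_eqVlt => /predU1P[<-|t0].
      rewrite scale0r mul0r; apply/eqP; rewrite eq_le; apply/andP; split.
        by apply: le_trans (infV _ _ Cq0) _; rewrite (sublinear0 (svalP q0).1).
      apply: lb_le_inf => // _ [q _ <-].
      by rewrite (sublinear0 (svalP q).1).
    apply/eqP; rewrite eq_le; apply/andP; split.
      rewrite -ler_pdivrMl //; apply: lb_le_inf => // _ [q Cq <-].
      by rewrite ler_pdivrMl // -((svalP q).1.2 _ _ (ltW t0)); exact: infV.
    apply: lb_le_inf => // _ [q Cq <-].
    by rewrite ((svalP q).1.2 _ _ (ltW t0)) ler_pM2l //; exact: infV.
  have ip u : inf (V u) <= p u.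
    exact: le_trans (infV _ _ Cq0) ((svalP q0).2 u).
  exists (exist _ (fun u => inf (V u)) (conj si ip)) => q Cq.
  by apply/asboolP => u; exact: infV.
- exists q; split=> // q' sq' q'q.
  have q'p u : q' u <= p u by exact: le_trans (q'q u) (qp u).
  have Sq : S (exist _ q (conj sq qp)) (exist _ q' (conj sq' q'p)).
    by apply/asboolP.
  by have /(congr1 sval) := qmin _ Sq.
Qed.

(** A minimal sublinear functional [q] is additive: replacing it by the
    infimum over [t >= 0] of [q (u + t v) - t q v] cannot make it smaller,
    and at [u = - v], [t = 1] this says that [q (- v) <= - q v]. *)
Lemma sublinear_dominates p : sublinear p -> exists q,
  (forall u v, q (u + v) = q u + q v) /\ forall u, q u <= p u.
Proof.
move=> /sublinear_minimal [q [sq qp qmin]]; exists q; split=> //.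
suff qN v : q (- v) <= - q v.
  move=> u v; apply/eqP; rewrite eq_le sq.1 /=.
  have := sq.1 (u + v) (- v); have := qN v; rewrite addrK; lra.
pose V u := [set q (u + t *: v) - t * q v | t in [set t | 0 <= t]].
have Vlb u : lbound (V u) (- q (- u)).
  move=> _ [t /= t0 <-]; have := sq.1 (u + t *: v) (- u).
  rewrite addrAC subrr add0r sq.2 //; lra.
have infV u t : 0 <= t -> inf (V u) <= q (u + t *: v) - t * q v.
  by move=> t0; apply: ge_inf; [exists (- q (- u))|exists t].
have Vne u : V u !=set0 by exists (q (u + 0 *: v) - 0 * q v), 0 => /=.
have inf_le u : inf (V u) <= q u.
  by have := infV u 0 (lexx _); rewrite scale0r mul0r addr0 subr0.
have si : sublinear (fun u => inf (V u)).
  split=> [u w|t u].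
    rewrite -lerBlDr; apply: lb_le_inf => // _ [t /= t0 <-].
    rewrite lerBlDr -lerBlDl; apply: lb_le_inf => // _ [s /= s0 <-].
    rewrite lerBlDl; apply: le_trans (infV _ (t + s) (addr_ge0 t0 s0)) _.
    have := sq.1 (u + t *: v) (w + s *: v); rewrite addrACA -scalerDl; lra.
  rewrite le_eqVlt => /predU1P[<-|t0].
    rewrite scale0r mul0r; apply/eqP; rewrite eq_le; apply/andP; split.
      by apply: le_trans (inf_le _) _; rewrite (sublinear0 sq).
    apply: lb_le_inf => // _ [s /= s0 <-].
    by rewrite add0r sq.2 // subrr.
  apply/eqP; rewrite eq_le; apply/andP; split.
    rewrite -ler_pdivrMl //; apply: lb_le_inf => // _ [s /= s0 <-].
    rewrite ler_pdivrMl // mulrBr -(sq.2 _ _ (ltW t0)) mulrA scalerDr scalerA.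
    by apply: infV; rewrite mulr_ge0 // ltW.
  apply: lb_le_inf => // _ [s /= s0 <-].
  have ti0 : 0 <= t^-1 by rewrite invr_ge0 ltW.
  rewrite -ler_pdivlMl // mulrBr -(sq.2 _ _ ti0) mulrA scalerDr !scalerA.
  by rewrite mulVf ?gt_eqF // scale1r; apply: infV; rewrite mulr_ge0.
have <- : inf (V (- v)) = q (- v) by rewrite -[in RHS](qmin _ si inf_le).
apply: le_trans (infV _ 1 ler01) _.
by rewrite scale1r addNr (sublinear0 sq) sub0r mul1r.
Qed.

End HahnBanach.

(** * Almost invariant finite sets from an invariant mean *)

Section Folner.
Variables (R : realType) (G : groupType).
Implicit Types (x y s g : G) (A S : seq G).

Lemma boundedP (f : G -> R^o) :
  (exists C : R, forall x, `|f x| <= C) -> bounded_fun f.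
Proof.
move=> [C fC]; exists C; split; first exact: num_real.
by move=> M CM x _; apply: le_trans (fC x) (ltW CM).
Qed.

Lemma boundedPex (f : G -> R^o) :
  bounded_fun f -> exists C : R, forall x, `|f x| <= C.
Proof. by move=> /ex_strict_bound_gt0[C _ fC]; exists C => x; exact/ltW/fC. Qed.

Lemma boundedD (f g : G -> R^o) : bounded_fun f -> bounded_fun g ->
  bounded_fun (fun x => f x + g x : R^o).
Proof.
move=> /boundedPex[C fC] /boundedPex[C' gC']; apply: boundedP.
by exists (C + C') => x; apply: le_trans (ler_normD _ _) (lerD _ _).
Qed.

Lemma boundedN (f : G -> R^o) : bounded_fun f ->
  bounded_fun (fun x => - f x : R^o).
Proof.
move=> /boundedPex[C fC]; apply: boundedP.
by exists C => x; rewrite normrN.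
Qed.

Lemma bounded_cst (c : R) : bounded_fun (fun _ : G => c : R^o).
Proof. by apply: boundedP; exists `|c|. Qed.

Lemma bounded_sum (I : Type) (r : seq I) (f : I -> G -> R^o) :
  (forall i, bounded_fun (f i)) ->
  bounded_fun (fun x => \sum_(i <- r) f i x : R^o).
Proof.
move=> fb; elim: r => [|i r ih].
  rewrite (_ : (fun x => _) = (fun=> 0)); last first.
    by apply/funext => x; rewrite big_nil.
  exact: bounded_cst.
rewrite (_ : (fun x => _) = (fun x => f i x + \sum_(i <- r) f i x)).
  exact: boundedD.
by apply/funext => x; rewrite big_cons.
Qed.

Lemma mean_sum_diff (m : (G -> R) -> R) S (psi : G -> G -> R) (C : R) :
  left_invariant_mean m -> (forall s x, `|psi s x| <= C) ->
  m (fun x => \sum_(s <- S) (psi s (s * x)%g - psi s x)) = 0.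
Proof.
move=> [mD mZ m_ge0 m1 minv] psiC.
have b1 s : bounded_fun (fun x => psi s x : R^o).
  by apply: boundedP; exists C.
have b2 s : bounded_fun (fun x => psi s (s * x)%g : R^o).
  by apply: boundedP; exists C.
have b3 s : bounded_fun (fun x => psi s (s * x)%g - psi s x : R^o).
  by apply: boundedD; [exact: b2|exact: boundedN].
elim: S => [|s S ih].
  have := mZ 0 (fun=> 1) (bounded_cst 1); rewrite [0 * m _]mul0r => m0.
  by apply: etrans m0; congr m; apply/funext => x; rewrite big_nil mul0r.
rewrite (_ : (fun x => _) = (fun x => psi s (s * x)%g - psi s x +
  \sum_(s <- S) (psi s (s * x)%g - psi s x))); last first.
  by apply/funext => x; rewrite big_cons.
rewrite mD //; last exact: bounded_sum.
rewrite ih addr0 mD //; last exact: boundedN.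
have -> : m (fun x => - psi s x) = - m (psi s).
  by rewrite -mulN1r -mZ //; congr m; apply/funext => x; rewrite mulN1r.
have := minv (s^-1)%g (psi s) (b1 s).
rewrite (_ : (fun x => _) = (fun x => psi s (s * x)%g)); last first.
  by apply/funext => x; rewrite invgK.
by move=> ->; rewrite subrr.
Qed.

(** Extended linearly to [D] in the group algebra, this is the family of
    the differences [s D - D] for [s] in [S], recorded as one finitely
    supported function on [G * G]: almost invariance of [D] under [S]
    becomes smallness of a single norm. *)
Definition displacement S x : {freeg (G * G) / R} :=
  \sum_(s <- S) (<< ((s * x)%g, s) >> - << (x, s) >>).

Lemma coeff_fglift (K L : choiceType) (F : K -> {freeg L / R}) D (z : L) :
  coeff z (fglift F D) = \sum_(x <- dom D) coeff x D * coeff z (F x).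
Proof. by rewrite fgliftE raddf_sum; apply: eq_bigr => x _; exact: coeffZ. Qed.

Lemma sum_coeff_eq (K : choiceType) (D : {freeg K / R}) (y : K) :
  \sum_(x <- dom D) coeff x D * (x == y)%:R = coeff y D.
Proof.
rewrite -{3}[D]freeg_sumE raddf_sum; apply: eq_bigr => x _.
by rewrite /= coeffU.
Qed.

Lemma coeff_displacement S (D : {freeg G / R}) y s :
  coeff (y, s) (fglift (displacement S) D) =
  (count_mem s S)%:R * (coeff (s^-1 * y)%g D - coeff y D).
Proof.
rewrite coeff_fglift -!(sum_coeff_eq D) -sumrB mulr_sumr.
apply: eq_bigr => x _; rewrite -mulrBr mulrCA; congr (_ * _).
rewrite /displacement raddf_sum -sum1_count natr_sum [in RHS]big_mkcond /=.
rewrite mulr_suml; apply: eq_bigr => s' _.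
rewrite coeffB !coeffU !mul1r !xpair_eqE.
have [->|_] := eqVneq s' s; last by rewrite !andbF subrr mul0r.
rewrite !andbT mul1r; congr ((_ : bool)%:R - _).
by rewrite -(inj_eq (mulgI s^-1)%g) mulKg.
Qed.

Lemma seq_argmin (K : eqType) (f : K -> R) (s : seq K) : s != [::] ->
  exists2 x, x \in s & forall y : K, y \in s -> f x <= f y.
Proof.
elim: s => // x [|x' s] ih _.
  by exists x; rewrite ?mem_head // => y; rewrite inE => /eqP->.
have [//|z zs zmin] := ih.
have [h|h] := leP (f x) (f z).
  exists x; rewrite ?mem_head // => y; rewrite inE => /predU1P[->//|/zmin].
  exact: le_trans.
exists z; first by rewrite inE zs orbT.
by move=> y; rewrite inE => /predU1P[->|/zmin//]; exact: ltW.
Qed.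

Definition indicator A : {freeg G / R} := \sum_(x <- A) << x >>.

Lemma coeff_indicator A y : uniq A -> coeff y (indicator A) = (y \in A)%:R.
Proof.
move=> uA; rewrite /indicator raddf_sum /=.
under eq_bigr do rewrite coeffU mul1r.
rewrite -(count_uniq_mem _ uA) -sum1_count natr_sum [in RHS]big_mkcond.
by apply: eq_bigr => x _ /=; case: (x == y).
Qed.

Lemma fgl1_indicator A : uniq A -> fgl1 (indicator A) = (size A)%:R.
Proof.
move=> uA; rewrite (fgl1_sub uA).
  rewrite -sum1_size natr_sum big_seq [RHS]big_seq; apply: eq_bigr => x xA.
  by rewrite coeff_indicator // xA normr1.
by move=> x; rewrite mem_dom coeff_indicator //; case: (x \in A); rewrite ?eqxx.
Qed.

(** Layer-cake decomposition: a nonnegative function is a positive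
    combination of the indicators of its superlevel sets, which are
    nested, and for nested sets the norms of the displacements add up. The
    induction removes the lowest layer, the support weighted by the least
    positive value. *)
Lemma displacement_layers S (eps : R) :
  (forall A, uniq A -> A != [::] ->
     eps * (size A)%:R <= fgl1 (fglift (displacement S) (indicator A))) ->
  forall D : {freeg G / R}, (forall x, 0 <= coeff x D) ->
    eps * fgl1 D <= fgl1 (fglift (displacement S) D).
Proof.
move=> isoper D; have [n] := ubnP (size (dom D)).
elim: n D => // n ih D; rewrite ltnS => szD Dge0.
have [D0|D0] := eqVneq (dom D) [::].
  move/eqP: D0; rewrite dom_eq0 => /eqP ->.
  by rewrite fglift0 !fgl1_0 mulr0.
have [x xD xmin] := seq_argmin (fun x => coeff x D) D0.
pose c := coeff x D; pose A := dom D; pose D' := D - c *: indicator A.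
have uA : uniq A := uniq_dom D.
have cD' y : coeff y D' = if y \in A then coeff y D - c else 0.
  rewrite coeffB coeffZ coeff_indicator //; case: ifP; rewrite ?mulr1 // mulr0.
  by move/negbT; rewrite mem_dom negbK => /eqP ->; rewrite subrr.
have D'ge0 y : 0 <= coeff y D'.
  by rewrite cD'; case: ifP => // yA; rewrite subr_ge0 xmin.
have c0 : 0 <= c by exact: Dge0.
have szD' : (size (dom D') < size (dom D))%N.
  have sub : {subset x :: dom D' <= dom D}.
    move=> y; rewrite inE => /predU1P[->//|].
    by rewrite mem_dom cD'; case: ifP; rewrite // eqxx.
  apply: (uniq_leq_size _ sub) => /=.
  by rewrite uniq_dom andbT mem_dom cD' xD subrr eqxx.
have DE : D = c *: indicator A + D' by rewrite addrC subrK.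
rewrite DE fgl1D_eq; last first.
  move=> y; have h : 0 <= coeff y (c *: indicator A).
    by rewrite coeffZ coeff_indicator // mulr_ge0.
  by rewrite !ger0_norm // addr_ge0.
rewrite fgliftD (@fgl1D_eq _ _ (fglift _ _)); last first.
  case=> y s; rewrite fgliftZ coeffZ !coeff_displacement !coeff_indicator //.
  rewrite mulrCA -mulrDr !(normrM _%:R) -mulrDr; congr (_ * _).
  rewrite !cD'; case: ifP => h1; case: ifP => h2.
  - by rewrite subrr mulr0 !add0r normr0 add0r.
  - have := xmin _ h1; rewrite !subr0 mulr1 -/c => h.
    rewrite addrC subrK ger0_norm ?Dge0 // (ger0_norm c0).
    by rewrite ger0_norm ?subr_ge0 // addrC subrK.
  - have := xmin _ h2; rewrite !sub0r mulrN1 -/c => h.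
    rewrite -opprD !normrN addrC subrK ger0_norm ?Dge0 // (ger0_norm c0).
    by rewrite ger0_norm ?subr_ge0 // addrC subrK.
  - by rewrite subrr mulr0 !add0r normr0 add0r.
rewrite mulrDr; apply: lerD; last by apply: ih => //; exact: leq_trans szD' szD.
rewrite fgliftZ !fgl1Z mulrCA ler_wpM2l // fgl1_indicator //; exact: isoper.
Qed.

(** Otherwise every nonnegative [D] satisfies [eps * |D| <= |d D|], with
    [d] the displacement, so that the infimum [p v] of
    [|v + d D| - eps * |D|] over nonnegative [D] is finite and sublinear.
    An additive functional [phi] below [p] is bounded by the norm, and
    [phi (d D) >= eps * |D|] for nonnegative [D]. Its values on basis
    elements form bounded functions [psi s] on [G] such that the sum over
    [s] of the differences of [psi s] and its translate by [s] is at least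
    [eps] everywhere. An invariant mean sends this sum to 0. *)
Lemma ex_almost_invariant S (eps : R) : amenable R G -> 0 < eps ->
  exists A, [/\ uniq A, A != [::] &
    fgl1 (fglift (displacement S) (indicator A)) < eps * (size A)%:R].
Proof.
move=> [m mmean] eps0; apply: contrapT => noA.
have isoper D : (forall x, 0 <= coeff x D) ->
    eps * fgl1 D <= fgl1 (fglift (displacement S) D).
  apply: displacement_layers => A uA A0; rewrite leNgt; apply/negP => h.
  by apply: noA; exists A.
pose P := [set D : {freeg G / R} | forall x, 0 <= coeff x D].
pose d (D : {freeg G / R}) := fglift (displacement S) D.
pose V (v : {freeg (G * G) / R}) :=
  [set fgl1 (v + d D) - eps * fgl1 D | D in P].
pose p v := inf (V v).
have P0 : P 0 by move=> x; rewrite coeff0.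
have PD D D' : P D -> P D' -> P (D + D').
  by move=> h h' x; rewrite coeffD addr_ge0.
have PZ t D : 0 <= t -> P D -> P (t *: D).
  by move=> t0 h x; rewrite coeffZ mulr_ge0.
have Vlb v : lbound (V v) (- fgl1 v).
  move=> _ [D PDD <-]; have := isoper D PDD; rewrite -/(d D).
  by have := fgl1B (v + d D) v; rewrite addrAC subrr add0r; lra.
have infV v D : P D -> p v <= fgl1 (v + d D) - eps * fgl1 D.
  by move=> h; apply: ge_inf; [exists (- fgl1 v)|exists D].
have Vne v : V v !=set0.
  by exists (fgl1 (v + d 0) - eps * fgl1 (0 : {freeg G / R})), 0.
have d0 : d 0 = 0 by exact: fglift0.
have p0 : p 0 = 0.
  apply/eqP; rewrite eq_le; apply/andP; split.
    by have := infV 0 0 P0; rewrite d0 addr0 !fgl1_0 mulr0 subrr.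
  apply: lb_le_inf => // _ [D h <-].
  by rewrite add0r subr_ge0; exact: isoper.
have psub : sublinear p.
  split=> [u v|t u].
    rewrite -lerBlDr; apply: lb_le_inf => // _ [D h <-].
    rewrite lerBlDr -lerBlDl; apply: lb_le_inf => // _ [D' h' <-].
    rewrite lerBlDl; apply: le_trans (infV _ (D + D') (PD _ _ h h')) _.
    have DD : fgl1 (D + D') = fgl1 D + fgl1 D'.
      by rewrite fgl1D_eq // => x; rewrite !ger0_norm ?addr_ge0.
    rewrite DD /d fgliftD addrACA.
    have := fgl1D (u + d D) (v + d D'); rewrite -!/(d _); lra.
  rewrite le_eqVlt => /predU1P[<-|t0]; first by rewrite scale0r mul0r.
  have pt t' v : 0 < t' -> p (t' *: v) <= t' * p v.
    move=> t'0; rewrite -ler_pdivrMl //; apply: lb_le_inf => // _ [D h <-].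
    rewrite ler_pdivrMl //; apply: le_trans (infV _ _ (PZ _ _ (ltW t'0) h)) _.
    by rewrite /d fgliftZ -scalerDr !fgl1Z gtr0_norm // mulrBr [eps * _]mulrCA.
  apply/eqP; rewrite eq_le pt //= -ler_pdivlMl //.
  apply: le_trans (pt _ _ _); rewrite ?invr_gt0 //.
  by rewrite scalerA mulVf ?gt_eqF // scale1r.
have [phi [phiD phip]] := sublinear_dominates psub.
have phi0 : phi 0 = 0 by apply: (addrI (phi 0)); rewrite -phiD !addr0.
have phiN u : phi (- u) = - phi u.
  by apply/eqP; rewrite -addr_eq0 -phiD addNr phi0.
have phi_le u : phi u <= fgl1 u.
  apply: le_trans (phip u) _; have := infV u 0 P0.
  by rewrite d0 addr0 fgl1_0 mulr0 subr0.
pose psi s x := phi << (x, s) >>.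
have psi1 s x : `|psi s x| <= 1.
  rewrite ler_norml lerNl -phiN.
  rewrite (le_trans (phi_le _)) ?fgl1N ?fgl1U //.
  by rewrite (le_trans (phi_le _)) ?fgl1U.
have psi_ge x : eps <= \sum_(s <- S) (psi s (s * x)%g - psi s x).
  have -> : \sum_(s <- S) (psi s (s * x)%g - psi s x) = phi (d << x >>).
    rewrite /d fglift1 (big_morph phi phiD phi0).
    by apply: eq_bigr => s _; rewrite phiD phiN.
  rewrite -[leRHS]opprK -phiN lerNr; apply: le_trans (phip _) _.
  have Px : P << x >> by move=> y; rewrite coeffU mul1r.
  by have := infV (- d << x >>) _ Px; rewrite addNr fgl1_0 fgl1U sub0r mulr1.
have m0 := mean_sum_diff S mmean psi1.
have [mD mZ m_ge0 m1 _] := mmean.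
set h := (fun x => \sum_(s <- S) _) in m0 psi_ge.
have hb : bounded_fun (h : G -> R^o).
  apply: bounded_sum => s; apply: boundedD.
    by apply: boundedP; exists 1.
  by apply: boundedN; apply: boundedP; exists 1.
have := m_ge0 (fun x => h x + - eps).
have -> : m (fun x => h x + - eps) = - eps.
  rewrite mD //; last exact: bounded_cst.
  rewrite m0 add0r; have := mZ (- eps) (fun=> 1) (bounded_cst 1).
  by rewrite m1 mulr1.
have hb' : bounded_fun (fun x => h x + - eps : R^o).
  by apply: boundedD => //; exact: bounded_cst.
move=> /(_ hb'); rewrite oppr_ge0 leNgt eps0 => H.
by have /H : forall x, 0 <= h x + - eps by move=> x; rewrite subr_ge0 psi_ge.
Qed.

(** The mean gives sets that are almost invariant on the left; taking
    inverses exchanges the two sides. *)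
Lemma folner S (eps : R) : amenable R G -> 0 < eps ->
  exists F : seq G, [/\ uniq F, F != [::] & forall s, s \in S ->
    (count [pred f | (f * s)%g \notin F] F)%:R <= eps * (size F)%:R].
Proof.
move=> am eps0; pose S' := [seq (s^-1)%g | s <- S].
have [A [uA A0 hA]] := ex_almost_invariant S' am eps0.
have uF : uniq [seq (a^-1)%g | a <- A].
  by rewrite map_inj_uniq //; exact: invg_inj.
exists [seq (a^-1)%g | a <- A]; split=> //; first by case: (A) A0.
move=> s sS; rewrite size_map; apply: le_trans (ltW hA).
pose B := [seq a <- A | (s^-1 * a)%g \notin A].
have -> : count [pred f | (f * s)%g \notin [seq (a^-1)%g | a <- A]]
            [seq (a^-1)%g | a <- A] = size B.
  rewrite count_map size_filter; apply: eq_count => a /=; congr negb.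
  by rewrite -[(a^-1 * s)%g]invgK invgM invgK mem_map //; exact: invg_inj.
(* Every [a] in [B] accounts for a coefficient of the displacement of [A] of
   absolute value at least 1, at the key [(s^-1 * a, s^-1)]. *)
pose t := [seq ((s^-1 * a)%g, s^-1%g) | a <- B].
have ut : uniq t.
  by rewrite map_inj_uniq ?filter_uniq // => a b [/mulgI].
apply: le_trans (fgl1_ge _ ut); rewrite big_map -sum1_size natr_sum.
rewrite big_seq [leRHS]big_seq; apply: ler_sum => a.
rewrite mem_filter => /andP[aA aA']; rewrite coeff_displacement.
rewrite !coeff_indicator // (negbTE aA) mulKg aA' subr0 mulr1.
rewrite normr_nat ler1n -has_count has_pred1.
exact: map_f.
Qed.

End Folner.

(** * Quasi-sections of a finite quotient by correlated sampling *)

Section RandomMinimum.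
Local Close Scope classical_set_scope.
Variable T : finType.
Implicit Types (X Y B : {set T}) (p : {perm T}).

(** The permutation [p] stands for the linear order on [T] in which
    [enum_rank (p z)] increases. *)
Definition is_first p X z :=
  (z \in X) && [forall w in X, (enum_rank (p z) <= enum_rank (p w))%N].

Lemma is_first_inj p X z w : is_first p X z -> is_first p X w -> z = w.
Proof.
move=> /andP[zX /forall_inP zm] /andP[wX /forall_inP wm].
apply/(@perm_inj _ p)/enum_rank_inj/ord_inj/eqP; rewrite eqn_leq.
by rewrite zm // wm.
Qed.

Lemma is_first_ex p X : X != finset.set0 -> exists z, is_first p X z.
Proof.
move=> /finset.set0Pn[z0 z0X].
have [z zX zm] := arg_minnP (fun z => (enum_rank (p z) : nat)) z0X.
by exists z; apply/andP; split=> //; apply/forall_inP.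
Qed.

Lemma is_first_sub p X Y z : X \subset Y -> z \in X -> is_first p Y z ->
  is_first p X z.
Proof.
move=> /fintype.subsetP XY zX /andP[_ /forall_inP zm]; rewrite /is_first zX.
by apply/forall_inP => w /XY; exact: zm.
Qed.

(** Composition with the transposition of [z] and [w] exchanges the two
    sets of orders. *)
Lemma card_is_first X z w : z \in X -> w \in X ->
  #|[pred p | is_first p X z]| = #|[pred p | is_first p X w]|.
Proof.
move=> zX wX; pose t := tperm z w.
have tX y : (t y \in X) = (y \in X).
  by rewrite /t; case: tpermP => [->|->|//]; rewrite ?zX ?wX.
have tt : t w = z by exact: tpermR.
rewrite -[RHS](fintype.card_image (mulgI t)).
apply: eq_card => p; apply/idP/fintype.imageP => /=.
  rewrite inE => /andP[_ /forall_inP zm]; exists (t^-1 * p)%g; last first.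
    by rewrite mulKVg.
  rewrite inE; apply/andP; split=> //; apply/forall_inP => y yX.
  by rewrite !permM tpermV tt; apply: zm; rewrite tX.
move=> [p' /andP[_ /forall_inP wm] ->]; rewrite inE.
apply/andP; split=> //; apply/forall_inP => y yX.
by rewrite !permM tpermL; apply: wm; rewrite tX.
Qed.

(** Under a uniformly random order every element of [X] is equally likely
    to be the first. *)
Lemma card_first_in X B : B \subset X ->
  (#|[pred p | [exists z in B, is_first p X z]]| * #|X| = #|B| * #|{perm T}|)%N.
Proof.
move=> BX; have cnt (Y : {set T}) : Y \subset X ->
    #|[pred p | [exists z in Y, is_first p X z]]| =
    (\sum_(z in Y) #|[pred p | is_first p X z]|)%N.
  move=> YX; rewrite -sum1_card.
  under [RHS]eq_bigr do rewrite -sum1_card.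
  rewrite [RHS](exchange_big_dep predT) //= [LHS]big_mkcond /=.
  apply: eq_bigr => p _; rewrite inE; case: ifP => [/exists_inP[z zY zf]|h].
    rewrite (big_pred1 z) // => w /=; rewrite inE.
    apply/andP/eqP => [[_ wf]|->//]; exact: is_first_inj wf zf.
  rewrite big_pred0 // => w; apply/negbTE; apply: contraFN h.
  by rewrite inE => /andP[wY wf]; apply/exists_inP; exists w.
have [/eqP X0|X0] := boolP (X == finset.set0).
  by move: BX; rewrite X0 finset.subset0 => /eqP ->; rewrite cards0 muln0.
have [z zX] := finset.set0Pn _ X0.
pose k := #|[pred p | is_first p X z]|.
have cntk (Y : {set T}) : Y \subset X ->
    #|[pred p | [exists z in Y, is_first p X z]]| = (#|Y| * k)%N.
  move=> YX; rewrite cnt // -sum_nat_const; apply: eq_bigr => w wY.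
  by apply: card_is_first => //; exact: (fintype.subsetP YX).
have tot : #|{perm T}| = (#|X| * k)%N.
  rewrite -(cntk X) //; apply: eq_card => p; rewrite !inE; apply/esym.
  have [w wf] := is_first_ex p X0.
  by apply/exists_inP; exists w => //; case/andP: wf.
by rewrite cntk // tot mulnAC mulnA.
Qed.

End RandomMinimum.

Section QuasiSection.
Local Close Scope classical_set_scope.
Variables (G : groupType) (Q : finGroupType) (phi : G -> Q).
Hypothesis phiM : {morph phi : x y / (x * y)%g}.
Implicit Types (x y : Q) (s g : G) (F S : seq G).

Lemma morph_one : phi 1%g = 1%g.
Proof. by apply: (mulgI (phi 1%g)); rewrite -phiM !mulg1. Qed.

Lemma morph_inv g : phi (g^-1)%g = (phi g)^-1%g.
Proof. by apply: (mulgI (phi g)); rewrite -phiM !mulgV morph_one. Qed.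

Section Candidates.
Variable F : seq G.
Hypothesis uF : uniq F.
Hypothesis F0 : F != [::].
Hypothesis phiF : {in F &, injective phi}.

Definition candidates x : {set Q} := [set z in [seq (phi f * x)%g | f <- F]].

Lemma candidatesP x z :
  reflect (exists2 f, f \in F & z = (phi f * x)%g) (z \in candidates x).
Proof. by rewrite inE; exact: mapP. Qed.

Lemma card_candidates x : #|candidates x| = size F.
Proof.
rewrite -(size_map (fun f => phi f * x)%g) -(card_uniqP _).
  by apply: eq_card => z; rewrite inE.
by rewrite map_inj_in_uniq // => f g fF gF /mulIg; exact: phiF.
Qed.

Lemma candidates_neq0 x : candidates x != finset.set0.
Proof. by rewrite -card_gt0 card_candidates lt0n size_eq0. Qed.

Section Translate.
Variable s : G.
Hypothesis phiFs : {in F ++ [seq (f * s)%g | f <- F] &, injective phi}.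

Let F_sub f : f \in F -> f \in F ++ [seq (f * s)%g | f <- F].
Proof. by rewrite mem_cat => ->. Qed.

Let Fs_sub f : f \in F -> (f * s)%g \in F ++ [seq (f * s)%g | f <- F].
Proof. by move=> fF; rewrite mem_cat (map_f (mulg^~ s)) ?orbT. Qed.

Variable x : Q.
Let x' := ((phi s)^-1 * x)%g.
Let A := (candidates x :|: candidates x')%SET.
Let B := (A :\: (candidates x :&: candidates x'))%SET.

(** A candidate of [x] that is not a candidate of [x'] comes from an [f]
    in [F] with [f * s] outside [F]. Both sets of candidates have [size F]
    elements, so the opposite difference has the same cardinality. *)
Lemma card_disagreement :
  (#|B| <= 2 * count [pred f | (f * s)%g \notin F] F)%N.
Proof.
have leD : (#|candidates x :\: candidates x'|%SET <=
            count [pred f | (f * s)%g \notin F] F)%N.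
  rewrite -size_filter -(size_map (fun f => phi f * x)%g).
  apply: leq_trans (card_size _); apply/subset_leq_card/fintype.subsetP => z.
  rewrite finset.in_setD => /andP[zx' /candidatesP[f fF zE]].
  apply/mapP; exists f => //; rewrite mem_filter fF andbT /=.
  apply: contra zx' => fsF; apply/candidatesP; exists (f * s)%g => //.
  by rewrite zE phiM /x' -mulgA mulVKg.
have eqD : #|candidates x' :\: candidates x|%SET =
           #|candidates x :\: candidates x'|%SET.
  apply: (@addnI #|candidates x :&: candidates x'|%SET).
  by rewrite cardsID finset.setIC cardsID !card_candidates.
have -> : B = ((candidates x :\: candidates x') :|:
               (candidates x' :\: candidates x))%SET.
  by apply/setP => z; rewrite !inE; do 2 case: (_ \in _).
apply: leq_trans (leq_card_setU _ _) _.
by rewrite eqD mul2n -addnn leq_add.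
Qed.

(** An element that is first in [A] and a common candidate is the first
    candidate of both [x] and [x']. Then [phi f'] and [phi (f * s)] agree,
    and injectivity of [phi] gives [f' = f * s]. *)
Lemma disagreement_first p f f' : f \in F -> f' \in F ->
  is_first p (candidates x) (phi f * x)%g ->
  is_first p (candidates x') (phi f' * x')%g ->
  f' != (f * s)%g -> [exists z in B, is_first p A z].
Proof.
move=> fF f'F fx fx' ne.
have A0 : A != finset.set0.
  have /finset.set0Pn[z zx] := candidates_neq0 x.
  by apply/finset.set0Pn; exists z; rewrite inE zx.
have [z zA] := is_first_ex p A0.
apply/exists_inP; exists z => //; rewrite inE (proj1 (andP zA)) andbT.
apply: contra ne; rewrite inE => /andP[zx zx'].
have e : z = (phi f * x)%g.
  apply: is_first_inj fx; apply: is_first_sub zx zA; exact: finset.subsetUl.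
have e' : z = (phi f' * x')%g.
  apply: is_first_inj fx'; apply: is_first_sub zx' zA; exact: finset.subsetUr.
apply/eqP/phiFs; [exact: F_sub|exact: Fs_sub|].
move: e'; rewrite e /x' mulgA phiM => /mulIg ->.
by rewrite -mulgA mulVg mulg1.
Qed.

Lemma card_disagreeing_orders :
  (#|[pred p | [exists z in B, is_first p A z]]| * size F <=
   2 * count [pred f | (f * s)%g \notin F] F * #|{perm Q}|)%N.
Proof.
have FA : (size F <= #|A|)%N.
  rewrite -(card_candidates x); apply: subset_leq_card; exact: finset.subsetUl.
apply: leq_trans (leq_mul (leqnn _) FA) _.
rewrite card_first_in; last exact: finset.subsetDl.
by rewrite leq_mul2r card_disagreement orbT.
Qed.

End Translate.

(** Correlated sampling: order [Q] at random and send [x] to the [f] in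
    [F] for which [phi f * x] comes first. For given [x] and [s] the
    equation [f ((phi s)^-1 * x) = f x * s] fails only if the first
    element of the union of the two sets of candidates is not common to
    both, which has probability at most [2 * k / size F]; some order is at
    least as good as the average. *)
Lemma ex_quasi_section S k :
  (forall s, s \in S -> {in F ++ [seq (f * s)%g | f <- F] &, injective phi}) ->
  (forall s, s \in S -> (count [pred f | (f * s)%g \notin F] F <= k)%N) ->
  exists f : Q -> G,
    (size F *
       (\sum_(s <- S) #|[pred x | f ((phi s)^-1 * x)%g != (f x * s)%g]|) <=
     2 * k * size S * #|Q|)%N.
Proof.
move=> inj cnt.
have ex_f p : exists f : Q -> G, forall x,
    f x \in F /\ is_first p (candidates x) (phi (f x) * x)%g.
  suff /boolp.choice[f fP] : forall x, exists g,
      g \in F /\ is_first p (candidates x) (phi g * x)%g by exists f.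
  move=> x; have [z zf] := is_first_ex p (candidates_neq0 x).
  have /candidatesP[g gF zE] := proj1 (andP zf).
  by exists g; rewrite -zE.
have [f fP] := boolp.choice ex_f.
pose bad p :=
  (\sum_(s <- S) #|[pred x | f p ((phi s)^-1 * x)%g != (f p x * s)%g]|)%N.
suff /existsP[p hp] : [exists p, (size F * bad p <= 2 * k * size S * #|Q|)%N].
  by exists (f p).
rewrite -[X in is_true X]negbK negb_exists; apply/negP => /forallP big.
have : (\sum_(p : {perm Q}) (size F * bad p) <=
        2 * k * size S * #|Q| * #|{perm Q}|)%N.
  rewrite -big_distrr /= exchange_big /= big_distrr /=.
  have -> : (2 * k * size S * #|Q| * #|{perm Q}| =
             \sum_(s <- S) \sum_(x : Q) 2 * k * #|{perm Q}|)%N.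
    rewrite big_const_seq count_predT iter_addn_0 sum_nat_const.
    by move: (size S) #|Q| #|{perm Q}| => a b c; lia.
  rewrite big_seq [leqRHS]big_seq; apply: leq_sum => s sS.
  under eq_bigr do rewrite -sum1_card big_mkcond /=.
  rewrite exchange_big /= big_distrr /=; apply: leq_sum => x _.
  rewrite -big_mkcond sum1_card mulnC.
  apply: leq_trans (leq_mul (subset_leq_card _) (leqnn _)) _; last first.
    apply: leq_trans (@card_disagreeing_orders s x) _.
    by rewrite leq_mul2r leq_mul2l (cnt s sS) !orbT.
  apply/fintype.subsetP => p; rewrite !inE => ne.
  have [fxF fx] := fP p x; have [fxF' fx'] := fP p ((phi s)^-1 * x)%g.
  exact: (disagreement_first (inj s sS) fxF fxF' fx fx' ne).
apply/negP; rewrite -ltnNge mulnC -sum_nat_const.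
rewrite (bigD1 1%g) //= [ltnRHS](bigD1 1%g) //= -addSn leq_add //.
  by rewrite ltnNge big.
by apply: leq_sum => p _; rewrite ltnW // ltnNge big.
Qed.

End Candidates.
End QuasiSection.

(** * Finite quotients of amenable residually finite groups *)

Section FiniteQuotients.
Variable G : groupType.
Implicit Types (g : G) (A : seq G).

Definition is_morphism (Q : finGroupType) (phi : G -> Q) : Prop :=
  {morph phi : x y / (x * y)%g}.

Lemma residually_finite_ntriv A : residually_finite G -> 1%g \notin A ->
  exists (Q : finGroupType) (phi : G -> Q),
    is_morphism phi /\ forall g, g \in A -> phi g != 1%g.
Proof.
move=> rf; elim: A => [_|g A ih].
  by exists {perm 'I_0}, (fun=> 1%g); split=> // x y; rewrite mulg1.
rewrite inE eq_sym negb_or => /andP[g1 /ih[Q [phi [phiM phiA]]]].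
have [H [f fg]] := rf g (elimN eqP g1).
exists (H * Q)%type, (fun x => (f x, phi x)); split.
  by move=> x y; rewrite phiM gmulfM.
move=> y; rewrite inE xpair_eqE negb_and => /predU1P[->|/phiA ->].
  by rewrite (introN eqP fg).
by rewrite orbT.
Qed.

Lemma residually_finite_inj A : residually_finite G ->
  exists (Q : finGroupType) (phi : G -> Q),
    is_morphism phi /\ {in A &, injective phi}.
Proof.
move=> rf; pose B :=
  [seq x <- [seq (p.1^-1 * p.2)%g | p <- allpairs pair A A] | x != 1%g].
have [|Q [phi [phiM phiB]]] := @residually_finite_ntriv B rf.
  by rewrite mem_filter eqxx.
exists Q, phi; split=> // x y xA yA e; apply/eqP; apply: contraT => xy.
suff /phiB : (x^-1 * y)%g \in B by rewrite phiM morph_inv // e mulVg eqxx.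
rewrite mem_filter -[X in X && _]negbK; apply/andP; split.
  by rewrite negbK -(inj_eq (mulgI x)) mulVKg mulg1 eq_sym.
by apply/mapP; exists (x, y) => //; apply: allpairs_f.
Qed.

Lemma surjective_corestriction (H : finGroupType) (phi : G -> H) A :
  is_morphism phi -> {in A &, injective phi} ->
  exists (Q : finGroupType) (psi : G -> Q), [/\ is_morphism psi,
    {in A &, injective psi} & forall x, exists g, psi g = x].
Proof.
move=> phiM phiA; pose K : {set H} := [set h | `[< exists g, phi g = h >]]%SET.
have KP h : reflect (exists g, phi g = h) (h \in K).
  by rewrite inE; exact: asboolP.
have gK : group_set K.
  apply/group_setP; split; first by apply/KP; exists 1%g; exact: morph_one.
  by move=> _ _ /KP[x <-] /KP[y <-]; apply/KP; exists (x * y)%g.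
have phiK g : phi g \in Group gK by apply/KP; exists g.
exists [subg (Group gK)], (fun g => subg (Group gK) (phi g)); split.
- by move=> x y; rewrite phiM subgM.
- move=> x y xA yA /(congr1 val); rewrite !subgK //; exact: phiA.
- move=> x; have /KP[g gx] : val x \in K := subgP x.
  by exists g; apply: val_inj; rewrite subgK.
Qed.

Lemma infinite_seq (N : nat) : infinite_set [set: G] ->
  exists A, uniq A /\ size A = N.
Proof.
move=> inf; elim: N => [|N [A [uA sA]]]; first by exists [::].
have [g gA] : exists g, g \notin A.
  apply: contrapT => nog; apply: inf; apply: (sub_finite_set _ (finite_seq A)).
  by move=> g _ /=; apply: contrapT => /negP gA; apply: nog; exists g.
by exists (g :: A); rewrite /= gA uA sA.
Qed.

(** An infinite group has quotients in which [N] further elements remain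
    distinct. For a finite group the order of [Q] is increased by a factor
    on which [phi] is trivial. *)
Lemma large_finite_quotient A (N : nat) : residually_finite G ->
  exists (Q : finGroupType) (phi : G -> Q), [/\ is_morphism phi,
    {in A &, injective phi}, (N <= #|Q|)%N &
    infinite_set [set: G] -> forall x, exists g, phi g = x].
Proof.
move=> rf; have [inf|fin] := pselect (infinite_set [set: G]); last first.
  have [Q [phi [phiM phiA]]] := residually_finite_inj A rf.
  exists (Q * {perm 'I_N})%type, (fun g => (phi g, 1%g)); split=> //.
  - by move=> x y; rewrite phiM -[X in (_, X)](mulg1 1%g).
  - by move=> x y xA yA [/phiA]; exact.
  - rewrite card_prod -[X in (X <= _)%N]mul1n leq_mul //.
      by apply/card_gt0P; exists 1%g.
    rewrite -[leqRHS]cardsT; have := card_Sn N; rewrite cardsT => ->.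
    by case: N => // N; rewrite factS leq_pmulr ?fact_gt0.
have [B [uB sB]] := infinite_seq N inf.
have [H [phi0 [phi0M phi0A]]] := residually_finite_inj (A ++ B) rf.
have [Q [phi [phiM phiA phi_surj]]] := surjective_corestriction phi0M phi0A.
exists Q, phi; split=> //.
  by move=> x y xA yA; apply: phiA; rewrite mem_cat ?xA ?yA.
have uB' : uniq (map phi B).
  rewrite map_inj_in_uniq // => x y xB yB; apply: phiA;
  by rewrite mem_cat ?xB ?yB orbT.
by rewrite -sB -(size_map phi) -(card_uniqP uB') max_card.
Qed.

Local Close Scope classical_set_scope.

(** A function [f] satisfying [f ((phi s)^-1 * x) = f x * s] for all [s]
    and [x] would determine [s] from [phi s]. Amenability provides a
    function for which the equation fails rarely. *)
Theorem quasi_section (R : realType) (S : seq G) (eps : R) (N : nat) :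
  amenable R G -> residually_finite G -> 0 < eps ->
  exists (Q : finGroupType) (phi : G -> Q) (f : Q -> G), [/\ is_morphism phi,
    infinite_set [set: G]%classic -> forall x, exists g, phi g = x,
    (N <= #|Q|)%N &
    forall s, s \in S ->
      (#|[pred x | f ((phi s)^-1 * x)%g != (f x * s)%g]|%:R : R) <=
      eps * #|Q|%:R].
Proof.
move=> am rf eps0.
(* The failures for all the elements of [S] are averaged together, which costs a
   factor [2 * size S]; the successor keeps [c] positive for empty [S]. *)
pose c : R := 2 * (size S).+1%:R.
have c0 : 0 < c by rewrite mulr_gt0.
have [F [uF F0 hF]] := folner S am (divr_gt0 eps0 c0).
pose T := F ++ [seq (f * s)%g | f <- F, s <- S].
have [Q [phi [phiM phiT NQ surj]]] := large_finite_quotient T N rf.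
pose k := \max_(s <- S) count [pred f | (f * s)%g \notin F] F.
have [|||f hf] := @ex_quasi_section G Q phi phiM F uF F0 _ S k.
- by move=> x y xF yF; apply: phiT; rewrite mem_cat ?xF ?yF.
- have sub s x : s \in S -> x \in F ++ [seq (f * s)%g | f <- F] -> x \in T.
    move=> sS; rewrite !mem_cat => /orP[->//|/mapP[f fF ->]].
    by rewrite allpairs_f ?orbT.
  by move=> s sS x y /(sub s x sS) xT /(sub s y sS) yT; exact: phiT.
- by move=> s sS; exact: (leq_bigmax_seq _ sS).
exists Q, phi, f; split=> // s sS.
have szF : (0 < size F)%N by rewrite lt0n size_eq0.
have kF : (k%:R : R) <= eps / c * (size F)%:R.
  rewrite /k big_seq; elim/big_ind: _ => [|m n hm hn|s' s'S].
  - by rewrite mulr_ge0 // ltW // divr_gt0.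
  - by rewrite /maxn; case: ifP.
  - exact: hF.
have szF' : 0 < (size F)%:R :> R by rewrite ltr0n.
rewrite -(ler_pM2l szF'); set b := #|_|.
have {}hf : (size F * b <= 2 * k * size S * #|Q|)%N.
  apply: leq_trans hf; rewrite leq_mul2l; apply/orP; right.
  by rewrite (big_rem s) //= leq_addr.
apply: (@le_trans _ _ (2 * k * size S * #|Q|)%:R).
  by rewrite -natrM ler_nat.
rewrite !natrM mulrA ler_wpM2r //.
have -> : (size F)%:R * eps = eps / c * (size F)%:R * (2 * (size S).+1%:R).
  by rewrite -/c mulrAC divfK ?gt_eqF // mulrC.
have -> : 2 * k%:R * (size S)%:R = k%:R * (2 * (size S)%:R) :> R.
  by rewrite mulrCA mulrA.
by rewrite ler_pM // ?mulr_ge0 // ler_pM2l // ler_nat.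
Qed.

End FiniteQuotients.

(** * Lifting homotopies along a covering *)

Section LocalContinuity.
Variables X Y Z : topologicalType.

Lemma cont_at_comp (f : X -> Y) (g : Y -> Z) (x : X) :
  {for x, continuous f} -> {for f x, continuous g} ->
  {for x, continuous (fun x => g (f x))}.
Proof. by move=> cf cg; apply: (continuous_comp cf cg). Qed.

Lemma cont_at_near (f g : X -> Y) (x : X) : (\near x, f x = g x) ->
  {for x, continuous g} -> {for x, continuous f}.
Proof.
move=> fg cg W /=; rewrite (nbhs_singleton fg) => /cg nW.
by apply: filterS2 fg nW => z /= ->.
Qed.

Lemma cont_at_paste (R : realType) (u : X -> R) (a : R) (f g : X -> Y) (x : X) :
  {for x, continuous u} -> (u x <= a -> {for x, continuous f}) ->
  (a <= u x -> {for x, continuous g}) -> (u x = a -> f x = g x) ->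
  {for x, continuous (fun x => if u x <= a then f x else g x)}.
Proof.
move=> cu cf cg fg W /=; case: (ltgtP (u x) a) => uxa nW.
- have nL : nbhs x (u @^-1` [set r | r < a]) by apply: cu; exact: lt_nbhsl.
  by apply: filterS2 nL (cf (ltW uxa) W nW) => z /= /ltW ->.
- have nL : nbhs x (u @^-1` [set r | a < r]) by apply: cu; exact: lt_nbhsr.
  by apply: filterS2 nL (cg (ltW uxa) W nW) => z /= az; rewrite leNgt az.
- have nW' := nW; rewrite (fg uxa) in nW'.
  have le1 : u x <= a by rewrite uxa.
  have le2 : a <= u x by rewrite uxa.
  have nf : nbhs x (f @^-1` W) := cf le1 W nW.
  by apply: filterS2 nf (cg le2 W nW') => z /= Wf Wg; case: ifP.
Qed.

End LocalContinuity.

Section Lifting.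
Variables (E M : topologicalType) (q : E -> M).
Hypothesis q_cov : covering q.
Implicit Types (e : E) (x : M).

Let q_cont : continuous q. Proof. by case: q_cov. Qed.

(** A local section [r] of [q] over the open set [U] whose image [V] is an
    open sheet through [e]. *)
Definition sheet (U : set M) e (V : set E) (r : M -> E) : Prop :=
  [/\ open V, V e, forall y, U y -> V (r y) /\ q (r y) = y,
      forall v, V v -> U (q v) /\ r (q v) = v &
      forall y, U y -> {for y, continuous r}].

(** The same [U] serves all the points above it: when a lift is extended
    in time, the sheet to be used depends on where the lift has arrived. *)
Lemma covering_sheets x : exists2 U, open_nbhs x U &
  forall e, U (q e) -> exists V r, sheet U e V r.
Proof.
case: q_cov => _ _ /(_ x)[U [oU Ux] [VV [oV _ qU hom]]].
exists U => // e Ue; have : (q @^-1` U) e by [].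
rewrite qU => -[V VVV Ve]; have [r [[fV iV sV] qK _ rcont]] := hom V VVV.
have qV v : V v -> U (q v) /\ r (q v) = v.
  by move=> Vv; split; [exact: fV|apply: qK; exact: mem_set].
exists V, r; split=> //; first exact: oV.
  by move=> y /sV[v Vv <-]; rewrite (proj2 (qV v Vv)).
move=> y Uy; move: rcont; rewrite continuous_open_subspace // => rc.
exact/rc/mem_set.
Qed.

Lemma covering_separated e e' : q e = q e' -> e <> e' ->
  exists A B : set E, [/\ open_nbhs e A, open_nbhs e' B & A `&` B = set0].
Proof.
move=> qe ne; case: q_cov => _ _ /(_ (q e))[U [oU Uqe] [VV [oV tV qU hom]]].
have [A VA Ae] : (\bigcup_(A in VV) A) e by rewrite -qU.
have [B VB Be] : (\bigcup_(A in VV) A) e' by rewrite -qU /= -qe.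
exists A, B; split; [split=> //; exact: oV|split=> //; exact: oV|].
apply/seteqP; split=> // z ABz; apply: ne.
have AB : A = B by apply: (tV A B VA VB); exists z.
have [r [[_ iA _] _ _ _]] := hom A VA.
by apply: iA => //; apply: mem_set => //; rewrite AB.
Qed.

Lemma lift_unique (Y : topologicalType) (g h : Y -> E) (y0 : Y) :
  connected [set: Y] -> continuous g -> continuous h ->
  (forall y, q (g y) = q (h y)) -> g y0 = h y0 -> g =1 h.
Proof.
move=> cY cg ch gh e0; pose B := [set y | g y = h y].
suff BT : B = [set: Y] by move=> y; have : B y by rewrite BT.
apply: cY; first by exists y0.
- exists B; last by rewrite setTI.
  rewrite openE => y /= By; have [U [oU Uy] sh] := covering_sheets (q (g y)).
  have [V [r [oV Vg _ rV _]]] := sh _ Uy.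
  have n1 : nbhs y (g @^-1` V) by apply: cg; exact: open_nbhs_nbhs.
  have n2 : nbhs y (h @^-1` V) by apply: ch; rewrite -By; exact: open_nbhs_nbhs.
  apply: filterS2 n1 n2 => z /= /rV[_ e1] /rV[_ e2].
  by rewrite /B /= -e1 -e2 gh.
- exists B; last by rewrite setTI.
  rewrite -openC openE => y /= nBy.
  have [A [A' [nA nA' AA']]] := covering_separated (gh y) nBy.
  have n1 : nbhs y (g @^-1` A) by apply: cg; exact: open_nbhs_nbhs.
  have n2 : nbhs y (h @^-1` A') by apply: ch; exact: open_nbhs_nbhs.
  apply: filterS2 n1 n2 => z /= Az A'z Bz.
  have : (A `&` A') (g z) by split=> //; rewrite Bz.
  by rewrite AA'.
Qed.

Section Homotopy.
Variables (R : realType) (Y : topologicalType) (F : Y * R -> M) (f : Y -> E).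
Hypotheses (F_cont : continuous F) (f_cont : continuous f).
Hypothesis F_init : forall y t, t <= 0 -> F (y, t) = q (f y).

Lemma connectedR : connected [set: R].
Proof. by apply/connected_intervalP => x y _ _ z _. Qed.

(** [g] lifts [F] near [y0] until time [t], when it stops moving. *)
Definition lifts_until (t : R) (N : set Y) (g : Y * R -> E) : Prop :=
  forall y, N y -> forall s, [/\ {for (y, s), continuous g},
    q (g (y, s)) = F (y, Num.min s t) & s <= 0 -> g (y, s) = f y].

Definition liftable y0 t := exists2 N, open_nbhs y0 N &
  exists g, lifts_until t N g.

Lemma liftable0 y0 t : t <= 0 -> liftable y0 t.
Proof.
move=> t0; exists setT; first exact: open_nbhsT.
exists (fun z => f z.1) => y _ s; split=> //.
  have : continuous (fun z : Y * R => f z.1).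
    by apply: contC => //; exact: cont_fst.
  exact.
by rewrite F_init // ge_min t0 orbT.
Qed.

Lemma cont_min_cst (t : R) (z : Y * R) :
  {for z, continuous (fun z => (z.1, Num.min z.2 t) : Y * R)}.
Proof.
have : continuous (fun z : Y * R => (z.1, Num.min z.2 t)).
  by apply: contP; [exact: cont_fst|apply: cont_min;
    [exact: cont_snd|exact: cont_cst]].
exact.
Qed.

Lemma liftable_le y0 t t' : t' <= t -> liftable y0 t -> liftable y0 t'.
Proof.
move=> tt' [N nN [g gP]]; exists N => //.
exists (fun z => g (z.1, Num.min z.2 t')) => y Ny s; split.
- apply: (@cont_at_comp _ _ _ (fun z => (z.1, Num.min z.2 t')) g).
    exact: cont_min_cst.
  by have [] := gP y Ny (Num.min s t').
- have [_ -> _] := gP y Ny (Num.min s t'); congr (F (_, _)).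
  by rewrite -minA (min_idPl tt').
- move=> s0; have [_ _] := gP y Ny (Num.min s t'); apply.
  by rewrite ge_min s0.
Qed.

(** The length of the step depends on [(y0, t0)] but not on the lift that
    is extended, so the set of times until which lifts exist is open and
    closed. *)
Lemma liftable_extend y0 t0 : exists2 d : R, 0 < d &
  forall t t', t0 - d < t -> t' < t0 + d -> liftable y0 t -> liftable y0 t'.
Proof.
have [U [oU Ux] sh] := covering_sheets (F (y0, t0)).
have [[/= N' I] [nN' nI] NIU] : nbhs (y0, t0) (F @^-1` U).
  by apply: F_cont; exact: open_nbhs_nbhs.
have /nbhs_ballP[d d0 dI] := nI; exists d => // t t' td t'd.
have [tt|tt] := leP t' t; first exact: liftable_le.
have UI y s : N' y -> t0 - d < s -> s < t0 + d -> U (F (y, s)).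
  move=> N'y s1 s2; apply: (NIU (y, s)); split=> //=; apply: dI.
  rewrite -ball_normE /= distrC ltr_norml; apply/andP; split; lra.
have td' : t < t0 + d by exact: lt_trans tt t'd.
move=> [N [oN Ny0] [g gP]].
have [cg0 qg0 _] := gP y0 Ny0 t.
have Ug0 : U (q (g (y0, t))).
  by rewrite qg0 min_l //; apply: UI => //; exact: nbhs_singleton nN'.
have [V [r [oV Vg rU rV r_cont]]] := sh _ Ug0.
have nV : nbhs y0 [set y | V (g (y, t))].
  have cp : {for y0, continuous (fun y : Y => (y, t))}.
    have : continuous (fun y : Y => (y, t)).
      by apply: contP; [exact: cont_id|exact: cont_cst].
    exact.
  apply: (@cont_at_comp _ _ _ (fun y => (y, t)) g y0 cp cg0).
  exact: open_nbhs_nbhs.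
pose N2 := (N `&` (N' `&` [set y | V (g (y, t))]))°.
exists N2.
  split; first exact: open_interior.
  by apply: filterI; [exact: open_nbhs_nbhs|exact: filterI].
exists (fun z => if z.2 <= t then g z else r (F (z.1, Num.min z.2 t'))).
move=> y /nbhs_singleton[Ny [N'y /= Vy]] s; split.
- apply: (@cont_at_paste _ _ _ (fun z : Y * R => z.2)) => /=.
  + exact: cont_snd.
  + by move=> _; have [] := gP y Ny s.
  + move=> ts.
    apply: (@cont_at_comp _ _ _ (fun z => F (z.1, Num.min z.2 t')) r).
      apply: (@cont_at_comp _ _ _ (fun z => (z.1, Num.min z.2 t')) F).
        exact: cont_min_cst.
      exact: F_cont.
    apply: r_cont => /=; apply: UI => //.
      by rewrite lt_min (lt_le_trans td ts) (lt_trans td tt).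
    by rewrite gt_min t'd orbT.
  + move=> ->; rewrite (min_l (ltW tt)).
    have [_ gyt _] := gP y Ny t; rewrite minxx in gyt.
    by rewrite -gyt; have [_ ->] := rV _ Vy.
- rewrite /=; case: ifP => st.
    have [_ -> _] := gP y Ny s.
    by rewrite !min_l // (le_trans st) // ltW.
  move/negbT: st; rewrite -ltNge => st.
  have [|_ ->//] := rU (F (y, Num.min s t')).
  apply: UI => //; first by rewrite lt_min (lt_trans td st) (lt_trans td tt).
  by rewrite gt_min t'd orbT.
- move=> s0 /=; case: ifP => st; first by have [_ _] := gP y Ny s; apply.
  move/negbT: st; rewrite -ltNge => st.
  have [_ gyt gf] := gP y Ny t; have [_ rq] := rV _ Vy.
  have t0' : t <= 0 by exact: ltW (lt_le_trans st s0).
  rewrite F_init ?ge_min ?s0 //.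
  by move: rq; rewrite gf.
Qed.

Lemma all_liftable y0 t : liftable y0 t.
Proof.
pose B := [set t | liftable y0 t].
suff BT : B = [set: R] by have : B t by rewrite BT.
apply: connectedR; first by exists 0; exact: liftable0.
- exists B; last by rewrite setTI.
  rewrite openE => s Bs; have [d d0 dP] := liftable_extend y0 s.
  apply/nbhs_ballP; exists d => // s'; rewrite -ball_normE /= ltr_norml.
  by move=> /andP[h1 h2]; apply: dP Bs; lra.
- exists B; last by rewrite setTI.
  rewrite -openC openE => s nBs; have [d d0 dP] := liftable_extend y0 s.
  apply/nbhs_ballP; exists d => // s'; rewrite -ball_normE /= ltr_norml.
  by move=> /andP[h1 h2] Bs'; apply: nBs; apply: dP Bs'; lra.
Qed.

Lemma lifts_until_eq t t' N N' g g' y s : lifts_until t N g ->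
  lifts_until t' N' g' -> N y -> N' y -> s <= t -> s <= t' ->
  g (y, s) = g' (y, s).
Proof.
move=> gP gP' Ny Ny' st st'.
have cm : continuous (fun u : R => (y, Num.min u s)).
  apply: contP; first exact: cont_cst.
  by apply: cont_min; [exact: cont_id|exact: cont_cst].
have := @lift_unique R (fun u => g (y, Num.min u s))
  (fun u => g' (y, Num.min u s)) (Num.min 0 s) connectedR _ _ _ _ s.
rewrite minxx; apply.
- move=> u; apply: (@cont_at_comp _ _ _ (fun u => (y, Num.min u s)) g u (cm u)).
  by have [] := gP y Ny (Num.min u s).
- move=> u.
  apply: (@cont_at_comp _ _ _ (fun u => (y, Num.min u s)) g' u (cm u)).
  by have [] := gP' y Ny' (Num.min u s).
- move=> u; have [_ -> _] := gP y Ny (Num.min u s).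
  have [_ -> _] := gP' y Ny' (Num.min u s).
  by rewrite -!minA (min_l st) (min_l st').
- have h : Num.min (Num.min 0 s) s <= 0 by rewrite -minA minxx ge_min lexx.
  have [_ _ ->//] := gP y Ny (Num.min (Num.min 0 s) s).
  by have [_ _ ->] := gP' y Ny' (Num.min (Num.min 0 s) s).
Qed.

(** By uniqueness of path lifts, the lifts obtained near different points
    agree where both are defined. *)
Lemma homotopy_lifting_real : exists L : Y * R -> E,
  [/\ continuous L, forall z, q (L z) = F z & forall y, L (y, 0) = f y].
Proof.
have ex_g (z : Y * R) : exists Ng : set Y * (Y * R -> E),
    open_nbhs z.1 Ng.1 /\ lifts_until z.2 Ng.1 Ng.2.
  by have [N nN [g gP]] := all_liftable z.1 z.2; exists (N, g).
have [S SP] := boolp.choice ex_g.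
exists (fun z => (S z).2 z); split.
- move=> [y0 s0]; have [[oN Ny0] gP] := SP (y0, s0 + 1).
  set N := (S _).1 in oN Ny0 gP; set g := (S _).2 in gP.
  apply: (@cont_at_near _ _ _ g); last by have [] := gP y0 Ny0 s0.
  exists (N, [set s | s < s0 + 1]).
    split=> /=; first exact: open_nbhs_nbhs.
    by apply: lt_nbhsl; rewrite ltrDl.
  move=> [y s] [/= Ny ss]; have [[_ Ny'] gP'] := SP (y, s).
  by apply: (lifts_until_eq gP' gP) => //; exact: ltW.
- move=> [y s]; have [[_ Ny] gP] := SP (y, s).
  by have [_ -> _] := gP y Ny s; rewrite minxx.
- move=> y; have [[_ Ny] gP] := SP (y, 0).
  by have [_ _ ->] := gP y Ny 0.
Qed.

End Homotopy.

Section Interval.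
Variable R : realType.
Local Notation I := (unit_interval R).

Lemma clamp0 : clamp (0 : R) = zero.
Proof. by []. Qed.

Lemma clamp1 : clamp (1 : R) = one.
Proof. by []. Qed.

Lemma homotopy_lifting (Y : topologicalType) (F : Y * I -> M) (f : Y -> E) :
  continuous F -> continuous f -> (forall y, F (y, zero) = q (f y)) ->
  exists L : Y * I -> E,
    [/\ continuous L, forall z, q (L z) = F z & forall y, L (y, zero) = f y].
Proof.
move=> cF cf F0; pose F' (z : Y * R) := F (z.1, clamp z.2).
have [|y t t0|L [cL qL L0]] := @homotopy_lifting_real R Y F' f _ cf.
- by rewrite /F'; cont.
- rewrite -F0 /F' /=; congr (F (_, _)); apply: ival_inj.
  by rewrite ival0 ival_clamp; apply/max_idPl; rewrite ge_min t0.
exists (fun z => L (z.1, ival z.2)); split.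
- by cont.
- by move=> [y t]; rewrite qL /F' /= ivalK.
- by move=> y; rewrite /= ival0 L0.
Qed.

(** [h] contracts [Y] to [y0] and keeps [y0] fixed. A map out of [Y] lifts
    along the tracks of [h]; as the track of [y0] is constant, the lift
    starts at [e]. *)
Lemma lift_contractible (Y : topologicalType) (h : Y * I -> Y) (y0 : Y)
    (f : Y -> M) e : continuous h -> (forall y, h (y, zero) = y0) ->
  (forall y, h (y, one) = y) -> (forall t, h (y0, t) = y0) ->
  continuous f -> q e = f y0 ->
  exists g : Y -> E, [/\ continuous g, forall y, q (g y) = f y & g y0 = e].
Proof.
move=> ch h0 h1 h2 cf qe.
have [||y|L [cL qL L0]] := @homotopy_lifting Y (fun z => f (h z)) (fun=> e).
- exact: contC.
- exact: cont_cst.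
- by rewrite h0.
exists (fun y => L (y, one)); split.
- by cont.
- by move=> y; rewrite qL h1.
have := @lift_unique R (fun t => L (y0, clamp t)) (fun=> e) 0 (@connectedR R).
rewrite clamp0 => /(_ _ _ _ (L0 y0) 1); rewrite clamp1; apply.
- by cont.
- exact: cont_cst.
- by move=> t; rewrite qL h2.
Qed.

Lemma lift_unique_tracks (Y : topologicalType) (h : Y * I -> Y) (y0 : Y)
    (g g' : Y -> E) : continuous h -> (forall y, h (y, zero) = y0) ->
  (forall y, h (y, one) = y) -> continuous g -> continuous g' ->
  (forall y, q (g y) = q (g' y)) -> g y0 = g' y0 -> g =1 g'.
Proof.
move=> ch h0 h1 cg cg' qg e0 y.
have := @lift_unique R (fun t => g (h (y, clamp t)))
  (fun t => g' (h (y, clamp t))) 0 (@connectedR R) _ _ _ _ 1.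
rewrite clamp1 !h1; apply.
- by cont.
- by cont.
- by move=> t; exact: qg.
- by rewrite clamp0 h0.
Qed.

End Interval.
End Lifting.

(** * The action of the fundamental group on the universal covering *)

Section PathsInSimplyConnected.
Variables (R : realType) (X : topologicalType).
Local Notation I := (unit_interval R).
Implicit Types x y z : X.

Lemma homotopic_cancel x y z (p : {path I from x to y})
    (r : {path I from y to z}) :
  homotopic (concat (concat p r) (reverse r)) p.
Proof.
apply: homotopic_trans (homotopic_sym (concatA _ _ _)) _.
apply: homotopic_trans (concatp1 p).
exact: homotopic_concat (homotopic_refl p) (concatpV r).
Qed.

Lemma homotopic_cancelV x y z (p : {path I from x to y})
    (r : {path I from z to y}) :
  homotopic (concat (concat p (reverse r)) r) p.
Proof.
apply: homotopic_trans (homotopic_sym (concatA _ _ _)) _.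
apply: homotopic_trans (concatp1 p).
exact: homotopic_concat (homotopic_refl p) (concatVp r).
Qed.

Lemma homotopic_cancel_loop x y (l : {path I from x to x})
    (p : {path I from x to y}) :
  homotopic (concat l p) p -> pi1_class l = 1%g.
Proof.
move=> lp; apply/pi1_classP; apply: homotopic_trans (concatpV p).
apply: homotopic_trans (homotopic_sym (homotopic_cancel l p)) _.
exact: homotopic_concat lp (homotopic_refl _).
Qed.

Lemma simply_connected_homotopic x y (p p' : {path I from x to y}) :
  simply_connected R X -> homotopic p p'.
Proof.
move=> [_ /(_ x (pi1_class (concat p (reverse p'))))/pi1_classP pp'].
apply: homotopic_trans (homotopic_sym (homotopic_cancelV p p')) _.
apply: homotopic_trans (concat1p p').
exact: homotopic_concat pp' (homotopic_refl p').
Qed.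

End PathsInSimplyConnected.

Lemma cont_pairl (X Y : topologicalType) (x : X) :
  continuous (fun y : Y => (x, y)).
Proof. by apply: contP; [exact: cont_cst|exact: cont_id]. Qed.

Local Notation rep := generic_quotient.repr.

Section Monodromy.
Variables (R : realType) (E M : topologicalType) (q : E -> M) (e0 : E).
Hypothesis q_cov : covering q.
Local Notation I := (unit_interval R).
Implicit Types (e : E) (x y : M).

Let q_cont : continuous q. Proof. by case: q_cov. Qed.

Definition is_lift (p : I -> M) e (g : I -> E) : Prop :=
  [/\ continuous g, forall t, q (g t) = p t & g zero = e].

(** The endpoint of the lift of [p] at [e]; the value [e] is a dummy for
    the case that there is no lift. *)
Definition transport e (p : I -> M) : E :=
  xget e [set e' | exists2 g, is_lift p e g & g one = e'].

Lemma is_lift_unique (p : I -> M) e g g' : is_lift p e g -> is_lift p e g' ->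
  g =1 g'.
Proof.
move=> [cg qg g0] [cg' qg' g0'] t.
have := lift_unique q_cov (g := fun s => g (clamp s))
  (h := fun s => g' (clamp s)) (y0 := 0) (@connectedR R) _ _ _ _ (ival t).
rewrite ivalK; apply.
- by cont.
- by cont.
- by move=> s; rewrite qg qg'.
- by rewrite clamp0 g0 g0'.
Qed.

Lemma transport_lift (p : I -> M) e g : is_lift p e g -> transport e p = g one.
Proof.
move=> gP; rewrite /transport; case: xgetP => [_ -> [g' gP' <-]|/(_ (g one))].
  exact: is_lift_unique gP' gP one.
by case; exists g.
Qed.

Lemma ex_lift x y (p : {path I from x to y}) e : q e = x ->
  exists g, is_lift p e g.
Proof.
move=> qe; have [|||L [cL qL L0]] :=
    @homotopy_lifting _ _ _ q_cov R I (fun z => p z.2) (fun=> e).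
- by cont.
- exact: cont_cst.
- by move=> t; rewrite /= path_zero.
exists (fun t => L (zero, t)); split=> //.
exact: (contC cL (@cont_pairl I I zero)).
Qed.

Lemma q_transport x y (p : {path I from x to y}) e : q e = x ->
  q (transport e p) = y.
Proof.
move=> /(ex_lift p)[g gP]; rewrite (transport_lift gP).
by case: gP => _ -> _; rewrite path_one.
Qed.

Lemma lift_path x y (p : {path I from x to y}) e e' : q e = x ->
  transport e p = e' ->
  exists g : {path I from e to e'}, forall t, q (g t) = p t.
Proof.
move=> /(ex_lift p)[g gP]; rewrite (transport_lift gP) => g1.
by case: gP => cg qg g0; exists (mk_path cg g0 g1).
Qed.

Lemma transport_concat x y z (p : {path I from x to y})
    (p' : {path I from y to z}) e : q e = x ->
  transport e (concat p p') = transport (transport e p) p'.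
Proof.
move=> qe; have [g gP] := lift_path qe (erefl (transport e p)).
have [g' gP'] :=
  lift_path (q_transport p qe) (erefl (transport (transport e p) p')).
rewrite (@transport_lift _ _ (concat g g')) ?path_one //; split.
- exact: cts_fun.
- move=> t; rewrite /concat /= /mk_path /concat_fun.
  by case: ifP; rewrite (gP, gP').
- by rewrite path_zero.
Qed.

(** In a lift of the homotopy, the endpoints of the lifted paths form a
    lift of a constant path. *)
Lemma transport_homotopic x y (p p' : {path I from x to y}) e : q e = x ->
  homotopic p p' -> transport e p = transport e p'.
Proof.
move=> qe [H [cH H0 H1 Hx Hy]].
have [|||L [cL qL L0]] :=
    @homotopy_lifting _ _ _ q_cov R I (fun z => H (z.2, z.1)) (fun=> e).
- by cont.
- exact: cont_cst.
- by move=> t; rewrite Hx.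
have l0 : is_lift p e (fun s => L (zero, s)).
  split=> [|s|//]; last by rewrite qL H0.
  exact: (contC cL (@cont_pairl I I zero)).
have l1 : is_lift p' e (fun s => L (one, s)).
  split=> [|s|//]; last by rewrite qL H1.
  exact: (contC cL (@cont_pairl I I one)).
rewrite (transport_lift l0) (transport_lift l1).
have lc : is_lift (fun=> y) (L (zero, one)) (fun t => L (t, one)).
  by split=> //; [cont|move=> t; rewrite qL Hy].
have lc' : is_lift (fun=> y) (L (zero, one)) (fun=> L (zero, one)).
  by split=> //; [exact: cont_cst|move=> t; rewrite qL Hy].
by rewrite (is_lift_unique lc lc' one).
Qed.

Hypothesis E_sc : simply_connected R E.

Lemma transport_inj x (p p' : {path I from q e0 to x}) :
  transport e0 p = transport e0 p' -> homotopic p p'.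
Proof.
move=> pp'; have [g gP] := lift_path (erefl (q e0)) pp'.
have [g' gP'] := lift_path (erefl (q e0)) (erefl (transport e0 p')).
have [H [cH H0 H1 Hx Hy]] := simply_connected_homotopic g g' E_sc.
exists (fun z => q (H z)); split.
- exact: contC q_cont cH.
- by move=> s; rewrite H0 gP.
- by move=> s; rewrite H1 gP'.
- by move=> t; rewrite Hx.
- by move=> t; rewrite Hy q_transport.
Qed.

Lemma ex_path_to e : exists p : {path I from q e0 to q e}, transport e0 p = e.
Proof.
have [[_ /(_ e0 e Logic.I Logic.I)[g _]] _] := E_sc.
have cg : continuous (fun t => q (g t)).
  by apply: (contC q_cont); exact: cts_fun.
have g0 : q (g zero) = q e0 by rewrite path_zero.
have g1 : q (g one) = q e by rewrite path_one.
exists (mk_path cg g0 g1).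
rewrite (@transport_lift _ _ g) ?path_one //; split=> //; first exact: cts_fun.
by rewrite path_zero.
Qed.

Definition path_to e : {path I from q e0 to q e} := projT1 (cid (ex_path_to e)).

Lemma transport_path_to e : transport e0 (path_to e) = e.
Proof. exact: projT2 (cid (ex_path_to e)). Qed.

Local Notation G := (pi1 R (q e0)).

(** The points of [E] correspond to the homotopy classes of paths in [M]
    that start at [q e0], and loops act by precomposition. *)
Definition deck (a : G) e : E := transport e0 (concat (rep a) (path_to e)).

Lemma deckE (l : {path I from q e0 to q e0}) x (p : {path I from q e0 to x}) :
  deck (pi1_class l) (transport e0 p) = transport e0 (concat l p).
Proof.
have [e qe pe] : exists2 e, q e = x & transport e0 p = e.
  by exists (transport e0 p) => //; exact: q_transport.
rewrite pe; case: _ / qe p pe => p pe.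
rewrite /deck; apply: transport_homotopic => //; apply: homotopic_concat.
  exact: repr_pi1_class.
by apply: transport_inj; rewrite transport_path_to.
Qed.

Lemma deckE_path a e x (p : {path I from q e0 to x}) : transport e0 p = e ->
  deck a e = transport e0 (concat (rep a) p).
Proof. by move=> <-; rewrite -{1}(pi1_classK a) deckE. Qed.

Lemma q_deck a e : q (deck a e) = q e.
Proof. exact: q_transport. Qed.

Lemma deckM a b e : deck (a * b)%g e = deck a (deck b e).
Proof.
rewrite (deckE_path a (erefl (deck b e))) -(transport_path_to e).
rewrite /= [(a * b)%g]/(pi1_class (concat (rep a) (rep b))) deckE.
rewrite transport_path_to; apply: transport_homotopic => //.
exact/homotopic_sym/concatA.
Qed.

Lemma deck1 e : deck 1%g e = e.
Proof.
rewrite -{1}(transport_path_to e) [1%g]/(pi1_class (cst_path R (q e0))) deckE.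
by rewrite (transport_homotopic _ (concat1p _)) ?transport_path_to.
Qed.

Lemma deck_free a e : deck a e = e -> a = 1%g.
Proof.
move=> ae; rewrite -(pi1_classK a).
apply: (homotopic_cancel_loop (p := path_to e)).
by apply: transport_inj; rewrite transport_path_to.
Qed.

Lemma deck_trans e e' : q e = q e' -> exists a, deck a e = e'.
Proof.
move=> qe.
have [p pe'] : exists p : {path I from q e0 to q e}, transport e0 p = e'.
  by rewrite qe; exact: ex_path_to.
exists (pi1_class (concat p (reverse (path_to e)))).
have := deckE (concat p (reverse (path_to e))) (path_to e).
rewrite transport_path_to => ->.
by rewrite (transport_homotopic _ (homotopic_cancelV _ _)).
Qed.

(** Over a path-connected neighbourhood of [q e] in an evenly covered set,
    a point near [e] is reached by a path in the sheet of [e]. Transport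
    along its projection, starting at [deck a e], stays in the sheet of
    [deck a e]. So near [e] the map [deck a] is [q] followed by a local
    section. *)
Lemma deck_continuous a : locally_path_connected R M -> continuous (deck a).
Proof.
move=> lpc e; have [U [oU Ue] sh] := covering_sheets q_cov (q e).
have [V [r [oV Ve rU rV r_cont]]] := sh e Ue.
have [|V' [r' [oV' Ve' rU' rV' r'_cont]]] := sh (deck a e).
  by rewrite q_deck.
have [W [[oW We] WU [_ Wpath]]] := lpc _ _ (open_nbhs_nbhs (conj oU Ue)).
apply: (@cont_at_near _ _ _ (fun e' => r' (q e'))); last first.
  by apply: cont_at_comp; [exact: q_cont|exact: r'_cont].
have nW : nbhs e (q @^-1` W) by apply: q_cont; exact: open_nbhs_nbhs.
apply: filterS2 nW (open_nbhs_nbhs (conj oV Ve)) => e' /= We' Ve''.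
have [g gW] := Wpath _ _ We We'.
have lift_g f s (B : set E) : q f = q e -> s (q e) = f ->
    (forall y, U y -> B (s y) /\ q (s y) = y) ->
    (forall y, U y -> {for y, continuous s}) -> transport f g = s (q e').
  move=> qf sf sU s_cont; rewrite (@transport_lift _ _ (fun t => s (g t))).
  + by rewrite path_one.
  + split=> [t|t|]; last by rewrite path_zero.
      apply: (@cont_at_comp _ _ _ g s); first exact: cts_fun.
      exact/s_cont/WU/gW.
    by have [] := sU _ (WU _ (gW t)).
have e'E : transport e0 (concat (path_to e) g) = e'.
  rewrite transport_concat // transport_path_to (lift_g e r V) //.
    by have [_ ->] := rV _ Ve''.
  by have [_ ->] := rV _ Ve.
rewrite (deckE_path a e'E) (transport_homotopic _ (concatA _ _ _)) //.
rewrite transport_concat // (lift_g _ r' V') //; first exact: q_deck.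
by have [_] := rV' _ Ve'; rewrite q_deck.
Qed.

End Monodromy.

(** * Barycentric coordinates, faces and the boundary operator *)

Section Barycentric.
Variable R : realType.
Local Notation I := (unit_interval R).

Definition bary n (u : stdsimplex R n) (j : 'I_n.+1) : R := coords u ord0 j.

Lemma bary_ge0 n (u : stdsimplex R n) j : 0 <= bary u j.
Proof.
by have [h _] : stdsimplex_set (coords u) := set_mem (valP u); exact: h.
Qed.

Lemma bary_sum n (u : stdsimplex R n) : \sum_j bary u j = 1.
Proof.
by have [_ h] : stdsimplex_set (coords u) := set_mem (valP u); exact: h.
Qed.

Lemma bary_inj n (u v : stdsimplex R n) : bary u =1 bary v -> u = v.
Proof. by move=> uv; apply/val_inj/rowP => j; exact: uv. Qed.

Lemma bary_cont n (j : 'I_n.+1) :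
  continuous (fun u : stdsimplex R n => bary u j).
Proof.
move=> u W /= nW.
suff h : nbhs (coords u) [set v | W (v ord0 j)].
  exact: (@coords_continuous R n u _ h).
exists (fun _ k => if k == j then W else setT).
  move=> i k; rewrite [i]ord1; case: eqP => [->//|_]; exact: filterT.
by move=> v /(_ ord0 j); rewrite eqxx.
Qed.

Lemma to_simplex_subproof n (v : 'I_n.+1 -> R) :
  (forall j, 0 <= v j) -> \sum_j v j = 1 ->
  (\row_j v j) \in @stdsimplex_set R n.
Proof.
move=> v0 v1; apply/mem_set; split=> [j|]; first by rewrite mxE.
by rewrite -[RHS]v1; apply: eq_bigr => j _; rewrite mxE.
Qed.

Definition to_simplex n (v : 'I_n.+1 -> R) (v0 : forall j, 0 <= v j)
    (v1 : \sum_j v j = 1) : stdsimplex R n :=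
  SigSub (to_simplex_subproof v0 v1).

Lemma bary_to_simplex n (v : 'I_n.+1 -> R) v0 v1 j :
  bary (@to_simplex n v v0 v1) j = v j.
Proof. exact: mxE. Qed.

Lemma cont_simplex n (X : topologicalType) (f : X -> stdsimplex R n) :
  (forall j, continuous (fun x => bary (f x) j)) -> continuous f.
Proof.
move=> cf; apply: continuous_comp_initial => x W [P nP PW].
have nj j : nbhs x [set y | P ord0 j (bary (f y) j)].
  exact: (cf j x _ (nP ord0 j)).
have nall : nbhs x [set y | forall j, P ord0 j (bary (f y) j)].
  exact: filter_forall nj.
apply: filterS nall => y Py; apply: PW => i j; rewrite [i]ord1; exact: Py.
Qed.

Lemma bary_face n (i : 'I_n.+2) (u : stdsimplex R n) j :
  bary (face i u) j = if unlift i j is Some k then bary u k else 0.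
Proof. exact: mxE. Qed.

Lemma bary_face_lift n (i : 'I_n.+2) (u : stdsimplex R n) k :
  bary (face i u) (fintype.lift i k) = bary u k.
Proof. by rewrite bary_face liftK. Qed.

Lemma bary_face_id n (i : 'I_n.+2) (u : stdsimplex R n) : bary (face i u) i = 0.
Proof. by rewrite bary_face unlift_none. Qed.

Section Contraction.
Variable n : nat.

Lemma vertex_ge0 (j : 'I_n.+1) : 0 <= (j == ord0)%:R :> R.
Proof. by []. Qed.

Lemma vertex_sum : \sum_(j < n.+1) (j == ord0)%:R = 1 :> R.
Proof. by rewrite (bigD1 ord0) //= big1 ?addr0 // => j /negbTE ->. Qed.

Definition vertex : stdsimplex R n := to_simplex vertex_ge0 vertex_sum.

Lemma shrink_ge0 (z : stdsimplex R n * I) (j : 'I_n.+1) :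
  0 <= (1 - ival z.2) * (j == ord0)%:R + ival z.2 * bary z.1 j.
Proof.
by rewrite addr_ge0 ?mulr_ge0 ?bary_ge0 ?ival_ge0 // subr_ge0 ival_le1.
Qed.

Lemma shrink_sum (z : stdsimplex R n * I) :
  \sum_(j < n.+1) ((1 - ival z.2) * (j == ord0)%:R + ival z.2 * bary z.1 j) = 1.
Proof.
by rewrite big_split /= -!mulr_sumr vertex_sum bary_sum !mulr1 subrK.
Qed.

Definition shrink (z : stdsimplex R n * I) : stdsimplex R n :=
  to_simplex (shrink_ge0 z) (shrink_sum z).

Lemma shrink_cont : continuous shrink.
Proof.
apply: cont_simplex => j.
have -> : (fun z => bary (shrink z) j) =
  (fun z => (1 - ival z.2) * (j == ord0)%:R + ival z.2 * bary z.1 j).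
  by apply/funext => z; exact: bary_to_simplex.
apply: contD; first by cont.
apply: contM; first by cont.
by apply: (contC (@bary_cont n j)); exact: cont_fst.
Qed.

Lemma shrink0 u : shrink (u, zero) = vertex.
Proof.
apply: bary_inj => j.
by rewrite !bary_to_simplex /= ival0 subr0 mul1r mul0r addr0.
Qed.

Lemma shrink1 u : shrink (u, one) = u.
Proof.
apply: bary_inj => j.
by rewrite bary_to_simplex /= ival1 subrr mul1r mul0r add0r.
Qed.

Lemma shrink_vertex t : shrink (vertex, t) = vertex.
Proof.
by apply: bary_inj => j; rewrite !bary_to_simplex /= -mulrDl subrK mul1r.
Qed.

End Contraction.

Section ConeParameter.
Variable n : nat.
Implicit Type t : stdsimplex R n.+1.

(* The bound 2^-1 keeps the denominator away from 0; it has an effect only in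
   the half of the simplex that is near the apex. *)
Let c t : R := Num.max (1 - bary t ord0) 2^-1.

Let c_gt0 t : 0 < c t.
Proof. by rewrite lt_max invr_gt0 ltr0n orbT. Qed.

Definition base_coord t (j : 'I_n.+1) : R :=
  bary t (fintype.lift ord0 j) / c t +
  (j == ord0)%:R * (1 - (1 - bary t ord0) / c t).

Lemma base_ge0 t j : 0 <= base_coord t j.
Proof.
rewrite addr_ge0 ?mulr_ge0 ?bary_ge0 ?invr_ge0 ?(ltW (c_gt0 t)) //.
by rewrite subr_ge0 ler_pdivrMr // mul1r /c le_max lexx.
Qed.

Lemma base_sum t : \sum_j base_coord t j = 1.
Proof.
rewrite big_split /= -!mulr_suml vertex_sum mul1r.
have -> : \sum_j bary t (fintype.lift ord0 j) = 1 - bary t ord0.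
  by rewrite -(bary_sum t) [in RHS]big_ord_recl [RHS]addrC addKr.
by rewrite addrC subrK.
Qed.

(** The projection of the cone onto its base, away from the apex; the
    vertex [ord0] of the base absorbs what is missing near the apex. *)
Definition base t : stdsimplex R n := to_simplex (base_ge0 t) (base_sum t).

Lemma c_cont : continuous (fun t => (c t)^-1).
Proof.
have cc : continuous c.
  have -> : c = (fun t => - Num.min (- (1 - bary t ord0)) (- 2^-1)).
    by apply/funext => t; rewrite oppr_min !opprK.
  apply: contN; apply: cont_min; last exact: cont_cst.
  apply: contN; apply: contD; first exact: cont_cst.
  by apply: contN; exact: bary_cont.
move=> t; have cN0 : c t != 0 by rewrite gt_eqF.
exact: (cvgV cN0 (cc t)).
Qed.

Lemma base_cont : continuous base.
Proof.
apply: cont_simplex => j.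
have -> : (fun t => bary (base t) j) = (fun t => base_coord t j).
  by apply/funext => z; exact: bary_to_simplex.
apply: contD; apply: contM.
- exact: bary_cont.
- exact: c_cont.
- exact: cont_cst.
- apply: contD; first exact: cont_cst.
  apply: contN; apply: contM; last exact: c_cont.
  by apply: contD; [exact: cont_cst|apply: contN; exact: bary_cont].
Qed.

Lemma base_half t j : bary t ord0 <= 2^-1 ->
  bary (base t) j = bary t (fintype.lift ord0 j) / (1 - bary t ord0).
Proof.
move=> t2; rewrite bary_to_simplex /base_coord.
have -> : c t = 1 - bary t ord0 by rewrite /c; apply/max_idPl; lra.
by rewrite divff ?subrr ?mulr0 ?addr0 //; apply/eqP; lra.
Qed.

End ConeParameter.

Lemma base_face0 n (u : stdsimplex R n) : base (face ord0 u) = u.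
Proof.
apply: bary_inj => j; rewrite base_half bary_face_id ?invr_ge0 ?ler0n //.
by rewrite bary_face_lift subr0 divr1.
Qed.

Lemma bary_face_lift0 n (i : 'I_n.+2) (u : stdsimplex R n.+1) :
  bary (face (fintype.lift ord0 i) u) ord0 = bary u ord0.
Proof.
have e : fintype.lift (fintype.lift ord0 i) ord0 = ord0 :> 'I_n.+3.
  exact: val_inj.
by rewrite -[in LHS]e bary_face_lift.
Qed.

Lemma base_face n (i : 'I_n.+2) (u : stdsimplex R n.+1) : bary u ord0 <= 2^-1 ->
  base (face (fintype.lift ord0 i) u) = face i (base u).
Proof.
have u0 := bary_face_lift0 i u.
move=> u2; apply: bary_inj => j; rewrite base_half u0 // [RHS]bary_face.
case: (unliftP i j) => [k ->|->]; last by rewrite bary_face_id mul0r.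
rewrite base_half //; congr (_ / _).
have -> : fintype.lift ord0 (fintype.lift i k) =
          fintype.lift (fintype.lift ord0 i) (fintype.lift ord0 k).
  by apply: val_inj; rewrite /= /bump /=; lia.
exact: bary_face_lift.
Qed.

End Barycentric.

Section Boundary.
Variables (R : realType) (X : topologicalType).
Local Notation Sing := (singular_simplex R).

Lemma boundary1 n (s : Sing n.+1 X) :
  boundary (<< s >> : chain R n.+1 X) =
  \sum_(i < n.+2) (-1 : int) ^+ i *: << (s \o face i : Sing n X) >>.
Proof. exact: fglift1. Qed.

(** Both sides insert zeros at the positions [i] and [i']. *)
Lemma face_face n (i i' : 'I_n.+3) (j j' : 'I_n.+2) (u : stdsimplex R n) :
  i' = fintype.lift i j -> i = fintype.lift i' j' ->
  face i (face j u) = face i' (face j' u).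
Proof.
move=> e e'; apply: bary_inj => c; rewrite bary_face.
case: (unliftP i c) => [k ->|->]; last first.
  by rewrite e' bary_face_lift bary_face_id.
case: (unliftP j k) => [l ->|->]; last by rewrite -e !bary_face_id.
have -> : fintype.lift i (fintype.lift j l) =
          fintype.lift i' (fintype.lift j' l).
  apply: val_inj => /=; move/(congr1 val): e; move/(congr1 val): e'.
  by rewrite /= /bump; lia.
by rewrite !bary_face_lift.
Qed.

(** Indexed by the ordered pair of the omitted vertices, the terms are
    antisymmetric; integral chains have no 2-torsion. *)
Lemma boundary_boundary n (c : chain R n.+2 X) : boundary (boundary c) = 0.
Proof.
rewrite /boundary fglift_comp fgliftE big1 // => s _.
suff -> : fglift (fun sigma : Sing n.+1 X =>
    \sum_(i < n.+2) (-1 : int) ^+ i *: << (sigma \o face i : Sing n X) >>)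
    (\sum_(i < n.+3)
       (-1 : int) ^+ i *: << (s \o face i : Sing n.+1 X) >>) = 0.
  by rewrite scaler0.
rewrite fglift_sum.
pose g (a b : 'I_n.+3) : chain R n X := if unlift a b is Some j
  then (-1) ^+ (a + j) *: << ((s \o face a) \o face j : Sing n X) >>
  else 0.
transitivity (\sum_a \sum_b g a b).
  apply: eq_bigr => a _.
  rewrite fgliftZ fglift1 [RHS](bigD1 a) //= {1}/g unlift_none add0r.
  rewrite [RHS](reindex_omap (fintype.lift a) (unlift a)) /=; last first.
    by move=> b; case: unliftP => [k ->//|->]; rewrite eqxx.
  rewrite scaler_sumr; apply: eq_big => [k|k _].
    by rewrite liftK eqxx eq_sym neq_lift.
  by rewrite /g liftK scalerA -exprD.
have gN a b : g a b = - g b a.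
  rewrite /g; case: (unliftP a b) => [j e|->]; last first.
    by rewrite unlift_none oppr0.
  case: (unliftP b a) => [j' e'|e']; last first.
    by move: e; rewrite e' => /eqP; rewrite -[_ == _]negbK neq_lift.
  rewrite -scaleNr; congr (_ *: _); last first.
    congr (<< _ >>); apply/continuousEP => u /=.
    by rewrite (face_face u e e').
  have : odd (a + j) = ~~ odd (b + j').
    move/(congr1 val): e; move/(congr1 val): e'.
    by rewrite /= /bump; lia.
  move=> ab; rewrite -signr_odd -[in RHS]signr_odd ab.
  by case: odd; rewrite ?opprK.
set S := (X in X = 0).
have SN : S = - S.
  by rewrite {1}/S exchange_big /= -sumrN; apply: eq_bigr => a _;
    rewrite -sumrN; apply: eq_bigr => b _.
apply/eqP/freeg_eqP => k; rewrite coeff0.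
by have := congr1 (coeff k) SN; rewrite coeffN; lia.
Qed.

End Boundary.

(** * Pushing chains forward and coning them off *)

Section Pushforward.
Variable R : realType.
Local Notation Sing := (singular_simplex R).

Definition push n (X Y : topologicalType) (f : continuousType X Y) :
    chain R n X -> chain R n Y :=
  fglift (fun s : Sing n X => << (f \o s : Sing n Y) >>).

Lemma push1 n (X Y : topologicalType) (f : continuousType X Y)
    (s : Sing n X) :
  push f << s >> = << (f \o s : Sing n Y) >>.
Proof. exact: fglift1. Qed.

Lemma boundary_push n (X Y : topologicalType) (f : continuousType X Y)
    (c : chain R n.+1 X) : boundary (push f c) = push f (boundary c).
Proof.
rewrite /boundary /push !fglift_comp; apply: fglift_eq => s.
rewrite fglift1 fglift_sum; apply: eq_bigr => i _.
rewrite fgliftZ fglift1; congr (_ *: << _ >>).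
exact/continuousEP.
Qed.

Lemma push_comp n (X Y Z : topologicalType) (f : continuousType X Y)
    (g : continuousType Y Z) (h : continuousType X Z) (c : chain R n X) :
  (forall x, g (f x) = h x) -> push g (push f c) = push h c.
Proof.
move=> gf; rewrite /push fglift_comp; apply: fglift_eq => s.
rewrite fglift1; congr (<< _ >>); apply/continuousEP => u; exact: gf.
Qed.

Lemma fgl1_push n (X Y : topologicalType) (f : continuousType X Y)
    (c : chain R n X) : fgl1 (push f c) <= fgl1 c.
Proof.
by rewrite -[leRHS]mul1r; apply: fgl1_fglift => s; rewrite fgl1U.
Qed.

End Pushforward.

Section Cone.
Variables (R : realType) (E : topologicalType) (x : E).
Local Notation Sing := (singular_simplex R).
Local Notation I := (unit_interval R).
Variable H : E * I -> E.
Hypotheses (H_cont : continuous H) (H0 : forall y, H (y, zero) = y)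
  (H1 : forall y, H (y, one) = x).

(** The contraction runs at double speed, so that the half of the simplex
    near the apex is mapped to [x]; on the other half [base] is the radial
    projection from the apex. *)
Definition cone_fun n (s : Sing n E) (t : stdsimplex R n.+1) : E :=
  H (s (base t), clamp (2 * bary t ord0)).

Lemma cone_continuous n (s : Sing n E) : continuous (cone_fun s).
Proof.
apply: (contC H_cont); apply: contP.
  by apply: (contC (@cts_fun _ _ s)); exact: base_cont.
apply: (contC (@clamp_continuous R)); apply: contM; first exact: cont_cst.
exact: bary_cont.
Qed.

Definition cone n (s : Sing n E) : Sing n.+1 E :=
  mkcts (@cone_continuous n s).

Lemma cone_apex n (s : Sing n E) t : 2^-1 <= bary t ord0 ->
  cone s t = x.
Proof.
move=> t2; rewrite /cone /= /mkcts /cone_fun.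
have -> : clamp (2 * bary t ord0) = one.
  apply: ival_inj; rewrite ival1 ival_clamp min_r ?max_r //; lra.
exact: H1.
Qed.

Lemma cone_face0 n (s : Sing n E) :
  (cone s \o face ord0 : Sing n E) = s.
Proof.
apply/continuousEP => u /=.
by rewrite /mkcts /cone_fun base_face0 bary_face_id mulr0 clamp0 H0.
Qed.

Lemma cone_face n (s : Sing n.+1 E) (i : 'I_n.+2) :
  (cone s \o face (fintype.lift ord0 i) : Sing n.+1 E) =
  cone (s \o face i : Sing n E).
Proof.
apply/continuousEP => u /=; have [u2|u2] := leP (bary u ord0) 2^-1.
  by rewrite /mkcts /cone_fun /= base_face // bary_face_lift0.
by rewrite !cone_apex ?bary_face_lift0 // ltW.
Qed.

Lemma cone_face1 (s : Sing 0 E) :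
  (cone s \o face (fintype.lift ord0 ord0) : Sing 0 E) =
  (mkcts (@cont_cst (stdsimplex R 0) E x) : Sing 0 E).
Proof.
apply/continuousEP => u /=; apply: cone_apex.
have e : fintype.lift (fintype.lift ord0 ord0) ord0 = ord0 :> 'I_2.
  exact: val_inj.
rewrite -[X in bary _ X]e bary_face_lift.
have := bary_sum u; rewrite big_ord1 => ->; lra.
Qed.

Definition cone_chain n : chain R n E -> chain R n.+1 E :=
  fglift (fun s => << cone s >>).

Lemma boundary_cone1 n (s : Sing n.+1 E) :
  boundary (cone_chain << s >>) = << s >> - cone_chain (boundary << s >>).
Proof.
rewrite /cone_chain fglift1 !boundary1 big_ord_recl expr0 scale1r cone_face0.
congr (_ + _); rewrite fglift_sum -sumrN; apply: eq_bigr => i _.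
by rewrite cone_face fgliftZ fglift1 exprS mulN1r scaleNr.
Qed.

Lemma boundary_cone0 (s : Sing 0 E) :
  boundary (cone_chain << s >>) =
  << s >> - << mkcts (@cont_cst (stdsimplex R 0) E x) : Sing 0 E >>.
Proof.
rewrite /cone_chain fglift1 boundary1 !big_ord_recl big_ord0.
rewrite cone_face0 cone_face1.
by rewrite expr0 scale1r addr0 expr1 scaleN1r.
Qed.

(** The boundary of the cone over [s] is [s] minus the cone over the
    boundary of [s] in positive degrees, and [s] minus the constant
    simplex at [x] in degree 0. In the boundary of an edge the constant
    simplices cancel. *)
Lemma cone_boundary n (c : chain R n.+1 E) :
  boundary (cone_chain (boundary c)) = boundary c.
Proof.
suff key : forall s : Sing n.+1 E,
    boundary (cone_chain (boundary << s >>)) = boundary << s >>.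
  rewrite -[c]freeg_sumE [boundary (\sum_(_ <- _) _)]fglift_sum.
  rewrite /cone_chain fglift_sum {1}/boundary fglift_sum; apply: eq_bigr => s _.
  by rewrite fgU_scale !fgliftZ; congr (_ *: _); exact: key.
move=> s; case: n s {c} => [|n] s; last first.
  rewrite [in LHS]boundary1 /cone_chain fglift_sum {1}/boundary fglift_sum.
  under eq_bigr do
    rewrite !fgliftZ [fglift _ (fglift _ _)]boundary_cone1 scalerBr.
  rewrite sumrB -boundary1 -[RHS]subr0; congr (_ - _).
  transitivity (cone_chain (boundary (boundary << s >>))).
    rewrite boundary1 {2}/boundary /cone_chain !fglift_sum.
    by apply: eq_bigr => i _; rewrite !fgliftZ.
  by rewrite boundary_boundary /cone_chain fglift0.
rewrite boundary1 !big_ord_recl big_ord0 addr0 expr0 scale1r expr1 scaleN1r.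
rewrite /cone_chain fgliftB /boundary fgliftB.
set s0 := (s \o _ : Sing 0 E).
set s1 := (s \o face (fintype.lift _ _) : Sing 0 E).
have := boundary_cone0 s0; have := boundary_cone0 s1.
rewrite /boundary /cone_chain => -> ->.
by rewrite opprB addrA subrK.
Qed.

Lemma fgl1_cone n (c : chain R n E) : fgl1 (cone_chain c) <= fgl1 c.
Proof.
by rewrite -[leRHS]mul1r; apply: fgl1_fglift => s; rewrite fgl1U.
Qed.

End Cone.

(** * The finite coverings associated with finite quotients *)

Section FinalTopology.
Variables (J : Type) (X : topologicalType) (T : choiceType).

(** [T] with the finest topology making every [i j] continuous. *)
Definition final_space (i : J -> X -> T) : Type := T.

Variable i : J -> X -> T.

HB.instance Definition _ := Choice.copy (final_space i) T.

Definition final_open : set (set (final_space i)) :=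
  [set U | forall j, open (i j @^-1` U)].

Lemma final_openT : final_open [set: final_space i].
Proof. by move=> j; rewrite preimage_setT; exact: openT. Qed.

Lemma final_openI : setI_closed final_open.
Proof. by move=> U V oU oV j; rewrite preimage_setI; exact: openI. Qed.

Lemma final_open_bigU (K : Type) (f : K -> set (final_space i)) :
  (forall k, final_open (f k)) -> final_open (\bigcup_k f k).
Proof.
by move=> of_ j; rewrite preimage_bigcup; apply: bigcup_open => k _; exact: of_.
Qed.

HB.instance Definition _ := isOpenTopological.Build (final_space i)
  final_openT final_openI final_open_bigU.

Lemma final_openP (U : set (final_space i)) :
  (forall j, open (i j @^-1` U)) -> open U.
Proof. by []. Qed.

Lemma final_map_continuous j : continuous (i j : X -> final_space i).
Proof. by apply/continuousP => U oU; exact: oU. Qed.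

Lemma final_continuous (Y : topologicalType) (f : final_space i -> Y) :
  (forall j, continuous (fun x => f (i j x))) -> continuous f.
Proof.
move=> cf; apply/continuousP => U oU.
by apply: final_openP => j; have /continuousP := cf j; exact.
Qed.

End FinalTopology.

(** What is used of a universal covering and its group of deck
    transformations. *)
Record deck_action (E M : topologicalType) (q : E -> M) (G : groupType)
    (act : G -> E -> E) : Prop := DeckAction {
  deck_covering : covering q;
  deck_cont : forall a, continuous (act a);
  deck_over : forall a e, q (act a e) = q e;
  deck_mul : forall a b e, act (a * b)%g e = act a (act b e);
  deck_one : forall e, act 1%g e = e;
  deck_fixed : forall a e, act a e = e -> a = 1%g;
  deck_fibre : forall e e', q e = q e' -> exists a, act a e = e' }.

Section AssociatedCovering.
Variables (E M : topologicalType) (q : E -> M) (G : groupType)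
  (act : G -> E -> E).
Hypothesis qA : deck_action q act.

Let q_cov : covering q. Proof. by case: qA. Qed.
Let act_cont a : continuous (act a). Proof. by case: qA. Qed.
Let q_act a e : q (act a e) = q e. Proof. by case: qA. Qed.
Let actM a b e : act (a * b)%g e = act a (act b e). Proof. by case: qA. Qed.
Let act1 e : act 1%g e = e. Proof. by case: qA. Qed.
Let act_free a e : act a e = e -> a = 1%g.
Proof. by case: qA => _ _ _ _ _ h _; exact: h. Qed.
Let act_trans e e' : q e = q e' -> exists a, act a e = e'.
Proof. case: qA => _ _ _ _ _ _; exact. Qed.

Variables (Q : finGroupType) (phi : G -> Q).
Hypothesis phiM : is_morphism phi.
Implicit Types (e : E) (a g : G) (y z w : Q).

Let ex_fibre_point x : exists e, q e = x.
Proof. by case: q_cov => _ /(_ x Logic.I)[e _ <-] _; exists e. Qed.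

Definition fibre_point x : E := projT1 (cid (ex_fibre_point x)).

Lemma q_fibre_point x : q (fibre_point x) = x.
Proof. exact: projT2 (cid (ex_fibre_point x)). Qed.

Let ex_coord e : exists a, act a (fibre_point (q e)) = e.
Proof. by apply: act_trans; rewrite q_fibre_point. Qed.

Definition fibre_coord e : G := projT1 (cid (ex_coord e)).

Lemma act_coord e : act (fibre_coord e) (fibre_point (q e)) = e.
Proof. exact: projT2 (cid (ex_coord e)). Qed.

Lemma act_inj a b e : act a e = act b e -> a = b.
Proof.
move=> ab; apply: (mulgI b^-1%g); rewrite mulVg; apply: (@act_free _ e).
by rewrite actM ab -actM mulVg act1.
Qed.

Lemma coord_act a e : fibre_coord (act a e) = (a * fibre_coord e)%g.
Proof.
apply: (@act_inj _ _ (fibre_point (q e))); rewrite actM act_coord.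
by rewrite -(q_act a) act_coord.
Qed.

(** The image of [(e, y)] in the quotient of [E * Q] by the diagonal
    action of [G]; a choice of one point in each fibre of [q] identifies
    the underlying set of that quotient with [M * Q]. *)
Definition assoc_map y e : M * Q := (q e, ((phi (fibre_coord e))^-1 * y)%g).

Definition assoc : Type := final_space assoc_map.

HB.instance Definition _ := Topological.on assoc.

Lemma assoc_map_act g y e : assoc_map (phi g * y)%g (act g e) = assoc_map y e.
Proof. by rewrite /assoc_map q_act coord_act phiM invMg -mulgA mulKg. Qed.

Lemma assoc_map_inj y z e : assoc_map y e = assoc_map z e -> y = z.
Proof. by case=> /mulgI. Qed.

Lemma assoc_map_eq y z e e' : assoc_map y e = assoc_map z e' ->
  exists g, e' = act g e /\ z = (phi g * y)%g.
Proof.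
move=> h; have [g ge] : exists g, act g e = e' by apply: act_trans; case: h.
exists g; split=> //; apply: (@assoc_map_inj _ _ e').
by rewrite -h -ge assoc_map_act.
Qed.

Lemma assoc_map_surj e (v : M * Q) : q e = v.1 -> exists y, assoc_map y e = v.
Proof.
case: v => x w /= qe; exists (phi (fibre_coord e) * w)%g.
by rewrite /assoc_map mulKg qe.
Qed.

Definition assoc_proj (v : assoc) : M := v.1.

Lemma assoc_proj_continuous : continuous assoc_proj.
Proof. by have [cq _ _] := q_cov; apply: final_continuous => y; exact: cq. Qed.

(** The preimage of the image of [V] under any of the maps [assoc_map z]
    is a union of translates of [V]. *)
Lemma assoc_map_open y (V : set E) : open V ->
  open (assoc_map y @` V : set assoc).
Proof.
move=> oV; apply: (@final_openP _ _ _ assoc_map) => z.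
rewrite openE => e' /= [v Vv /assoc_map_eq[g [-> zE]]].
have nV : nbhs (act g v) (act g^-1%g @^-1` V).
  apply: act_cont; rewrite -actM mulVg act1; exact: open_nbhs_nbhs.
apply: filterS nV => e /= Ve; exists (act g^-1%g e) => //.
by rewrite -(assoc_map_act g) zE -actM mulgV act1.
Qed.

Lemma assoc_covering : covering assoc_proj.
Proof.
split; first exact: assoc_proj_continuous.
  by move=> x _; exists ((x, 1%g) : assoc).
move=> x; have [U nU sh] := covering_sheets q_cov x; exists U => //.
have [oU Ux] := nU.
have [|V [r [oV Ve rU rV r_cont]]] := sh (fibre_point x).
  by rewrite q_fibre_point.
exists [set (assoc_map y @` V : set assoc) | y in [set: Q]]; split.
- by move=> _ [y _ <-]; exact: assoc_map_open.
- move=> _ _ [y _ <-] [z _ <-] [_ [[v Vv <-] [v' Vv' vv']]].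
  have e : v = v'.
    have [_ <-] := rV _ Vv; have [_ <-] := rV _ Vv'.
    by case: vv' => ->.
  by move: vv'; rewrite e => /assoc_map_inj ->.
- apply/seteqP; split=> [v Uv|_ [_ [y _ <-] [v Vv <-]]].
    have [Vr qr] := rU _ Uv; have [y yv] := assoc_map_surj qr.
    by exists (assoc_map y @` V); [exists y|exists (r v.1)].
  by have [] := rV _ Vv.
- move=> _ [y _ <-].
  have K v : V v -> r (q v) = v by move=> /rV[].
  exists (fun x => assoc_map y (r x)); split.
  + split.
    * by move=> _ [v Vv <-]; have [] := rV _ Vv.
    * move=> _ _ /set_mem[v Vv <-] /set_mem[v' Vv' <-] /= vv'.
      by rewrite -(K v Vv) -(K v' Vv') vv'.
    * move=> m Um; have [Vr qr] := rU _ Um.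
      by exists (assoc_map y (r m)) => //; exists (r m).
  + by move=> _ /set_mem[v Vv <-]; rewrite /assoc_proj /= K.
  + exact: continuous_subspaceT assoc_proj_continuous.
  + apply: continuous_in_subspaceT => m /set_mem Um.
    apply: (@cont_at_comp _ _ _ r (assoc_map y : E -> assoc)).
      exact: r_cont.
    exact: final_map_continuous.
Qed.

Lemma assoc_regular : regular_covering assoc_proj.
Proof.
split; first exact: assoc_covering.
pose h w (v : assoc) : assoc := (v.1, (v.2 * w)%g).
have h_cont w : continuous (h w).
  apply: final_continuous => y.
  have -> : (fun e => h w (assoc_map y e)) = assoc_map (y * w)%g.
    by apply/funext => e; rewrite /h /assoc_map /= mulgA.
  exact: final_map_continuous.
have hK w : cancel (h w) (h w^-1%g) by case=> x z; rewrite /h /= mulgK.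
have hVK w : cancel (h w^-1%g) (h w) by case=> x z; rewrite /h /= mulgVK.
move=> [x z] [x' z']; rewrite /assoc_proj /= => <-.
exists (h (z^-1 * z')%g); last by rewrite /h /= mulVKg.
by split=> //; exists (h (z^-1 * z')^-1%g).
Qed.

Lemma assoc_degree : covering_degree assoc_proj #|Q|.
Proof.
move=> x; apply/card_set_bijP.
exists (fun v : assoc => enum_rank v.2 : nat); split.
- by move=> v _ /=; exact: ltn_ord.
- move=> [m y] [m' z] /set_mem/= -> /set_mem/= ->.
  by move=> /val_inj/enum_rank_inj ->.
- move=> k /= kQ; exists ((x, enum_val (Ordinal kQ)) : assoc) => //.
  by rewrite enum_valK.
Qed.

Lemma assoc_path_connected (R : realType) : (forall z, exists g, phi g = z) ->
  path_connected R E -> path_connected R assoc.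
Proof.
move=> phi_surj [[e _] Epath].
have surj v : exists e, assoc_map 1%g e = v.
  have [y <-] := assoc_map_surj (q_fibre_point v.1).
  have [g gy] := phi_surj y^-1%g; exists (act g (fibre_point v.1)).
  by rewrite -(assoc_map_act g y) gy mulVg.
split; first by exists ((q e, 1%g) : assoc).
move=> v v' _ _; have [e1 <-] := surj v; have [e2 <-] := surj v'.
have [g _] := Epath e1 e2 Logic.I Logic.I.
have cg : continuous (fun t => assoc_map 1%g (g t) : assoc).
  apply: (@contC _ _ _ g (assoc_map 1%g : E -> assoc)).
    exact: final_map_continuous.
  exact: cts_fun.
have g0 : assoc_map 1%g (g zero) = assoc_map 1%g e1 by rewrite path_zero.
have g1 : assoc_map 1%g (g one) = assoc_map 1%g e2 by rewrite path_one.
by exists (@mk_path _ assoc _ _ _ cg g0 g1).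
Qed.


Section Chains.
Variable R : realType.
Local Notation Sing := (singular_simplex R).

Definition sheet_map y : continuousType E assoc :=
  mkcts (@final_map_continuous _ _ _ assoc_map y).

Definition covering_map : continuousType assoc M := mkcts assoc_proj_continuous.

Definition universal_map : continuousType E M :=
  mkcts (let: And3 h _ _ := q_cov in h : continuous q).

Definition act_map g : continuousType E E := mkcts (@act_cont g).

Lemma lifts_of_simplex n (s : Sing n E) :
  [set tau : Sing n assoc |
     covering_map \o tau = universal_map \o s :> (stdsimplex R n -> M)] =
  [set (sheet_map y \o s : Sing n assoc) | y in [set: Q]].
Proof.
apply/seteqP; split=> [tau /= tauE|_ [y _ <-] //].
have [y yE] := assoc_map_surj (esym (congr1 (@^~ (vertex R n)) tauE)).
exists y => //; apply/continuousEP.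
apply: (lift_unique_tracks assoc_covering (@shrink_cont R n) (@shrink0 R n)
  (@shrink1 R n)) => //.
- exact: cts_fun.
- exact: cts_fun.
- by move=> u; have := congr1 (@^~ u) tauE.
Qed.

Lemma full_lift_simplex n (s : Sing n E) :
  full_lift covering_map
    (<< (universal_map \o s : Sing n M) >> : chain R n M) =
  \sum_(y : Q) (<< (sheet_map y \o s : Sing n assoc) >> : chain R n assoc).
Proof.
pose r := [seq (sheet_map y \o s : Sing n assoc) | y <- enum Q].
have ur : uniq r.
  rewrite map_inj_uniq ?enum_uniq // => y z /continuousEP/(_ (vertex R n)).
  exact: assoc_map_inj.
rewrite /full_lift fglift1 lifts_of_simplex.
have -> : [set (sheet_map y \o s : Sing n assoc) | y in [set: Q]] =
          [set` r].
  apply/seteqP; split=> [_ [y _ <-]|tau /mapP[y _ ->]] /=; last by exists y.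
  by apply: map_f; rewrite mem_enum.
by rewrite -fsbig_seq // big_map big_enum.
Qed.

Lemma full_lift_push n (c : chain R n E) :
  full_lift covering_map (push universal_map c) =
  \sum_(y : Q) push (sheet_map y) c.
Proof.
rewrite [LHS]fglift_comp.
have -> : \sum_(y : Q) push (sheet_map y) c = fglift (fun s : Sing n E =>
    \sum_(y : Q)
      (<< (sheet_map y \o s : Sing n assoc) >> : chain R n assoc)) c.
  rewrite [RHS]fgliftE; under [RHS]eq_bigr do rewrite scaler_sumr.
  by rewrite exchange_big; apply: eq_bigr => y _; rewrite /= -fgliftE.
by apply: fglift_eq => s; rewrite -full_lift_simplex.
Qed.

Section Filling.
Local Notation I := (unit_interval R).
Variables (x : E) (H : E * I -> E).
Hypotheses (H_cont : continuous H) (H0 : forall e, H (e, zero) = e)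
  (H1 : forall e, H (e, one) = x).
Variable f : Q -> G.

(** Without the cones, the summand of [y] would be the image of [c] under
    [sheet_map y], because [sheet_map (phi g * y)] composed with the
    action of [g] is [sheet_map y]. The cones themselves depend on the
    choice of [g = f y]. *)
Definition filling n (c : chain R n E) : chain R n.+1 assoc :=
  \sum_(y : Q) push (sheet_map (phi (f y) * y)%g)
    (cone_chain H_cont (push (act_map (f y)) c)).

Lemma fillingB n (c1 c2 : chain R n E) :
  filling (c1 - c2) = filling c1 - filling c2.
Proof.
rewrite /filling -sumrB; apply: eq_bigr => y _.
by rewrite /push /cone_chain !fgliftB.
Qed.

Lemma filling_fglift n (K : choiceType) (F : K -> chain R n E)
    (c : {freeg K / int}) :
  filling (fglift F c) = fglift (fun k => filling (F k)) c.
Proof.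
rewrite /filling [RHS]fgliftE; under [RHS]eq_bigr do rewrite scaler_sumr.
rewrite exchange_big; apply: eq_bigr => y _ /=.
rewrite [fglift F c]fgliftE /push /cone_chain !fglift_sum.
apply: eq_bigr => k _; by rewrite !fgliftZ.
Qed.

Lemma boundary_filling n (c : chain R n.+1 E) :
  boundary (filling (boundary c)) =
  \sum_(y : Q) push (sheet_map y) (boundary c).
Proof.
rewrite /filling [LHS]fglift_sum; apply: eq_bigr => y _.
rewrite [LHS]boundary_push -(boundary_push (act_map (f y))).
rewrite (cone_boundary H_cont H0 H1) boundary_push.
apply: push_comp => e; exact: assoc_map_act.
Qed.

Lemma fgl1_filling n (c : chain R n E) : fgl1 (filling c) <= #|Q|%:R * fgl1 c.
Proof.
apply: le_trans (fgl1_sum _ _ _) _.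
rewrite mulr_natl -sumr_const; apply: ler_sum => y _.
apply: le_trans (fgl1_push _ _) _; apply: le_trans (fgl1_cone _ _) _.
exact: fgl1_push.
Qed.

Let piece n (s : Sing n E) z g : chain R n.+1 assoc :=
  push (sheet_map z) (cone_chain H_cont << (act_map g \o s : Sing n E) >>).

Let fgl1_piece n (s : Sing n E) z g : fgl1 (piece s z g) <= 1.
Proof.
apply: le_trans (fgl1_push _ _) _; apply: le_trans (fgl1_cone _ _) _.
by rewrite fgl1U.
Qed.

(** After the substitution of [(phi g)^-1 * y] for [y] in the filling of
    [s], its summands cancel against those of the filling of [g s]
    wherever [f ((phi g)^-1 * y) = f y * g]. *)
Lemma fgl1_filling_diff n (s : Sing n E) g :
  fgl1 (filling (<< s >> - << (act_map g \o s : Sing n E) >>)) <=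
  2 * #|[pred y | f ((phi g)^-1 * y)%g != (f y * g)%g]|%:R.
Proof.
have e1 : filling << s >> = \sum_(y : Q) piece s
    (phi (f ((phi g)^-1 * y)) * ((phi g)^-1 * y))%g (f ((phi g)^-1 * y)%g).
  rewrite /filling (reindex_inj (mulgI (phi g)^-1%g)) /=.
  by apply: eq_bigr => y _; rewrite push1.
have e2 : filling << (act_map g \o s : Sing n E) >> =
    \sum_(y : Q) piece s (phi (f y) * y)%g (f y * g)%g.
  apply: eq_bigr => y _; rewrite push1 /piece.
  congr (push _ (cone_chain _ << _ >>)).
  by apply/continuousEP => u /=; rewrite /mkcts actM.
rewrite fillingB e1 e2 -sumrB; apply: le_trans (fgl1_sum _ _ _) _.
rewrite -sum1_card natr_sum mulr_sumr [leRHS]big_mkcond /=.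
apply: ler_sum => y _; rewrite inE; case: eqP => [->|_] /=.
  by rewrite phiM -mulgA mulKVg subrr fgl1_0.
rewrite mulr1; apply: le_trans (fgl1B _ _) _.
exact: (lerD (fgl1_piece _ _ _) (fgl1_piece _ _ _)).
Qed.

End Filling.
End Chains.
End AssociatedCovering.

(** * Fillings of the full lifts *)

Section UniformBoundary.
Variables (R : realType) (E M : topologicalType) (q : E -> M) (G : groupType)
  (act : G -> E -> E).
Hypothesis qA : deck_action q act.
Hypothesis E_contractible : contractible R E.
Hypothesis E_path : path_connected R E.
Hypothesis G_amenable : amenable R G.
Hypothesis G_rf : residually_finite G.

Local Notation Sing := (singular_simplex R).
Local Notation qmap := (universal_map qA).
Local Notation amap := (act_map qA).

Lemma ex_simplex_lift n (s : Sing n M) :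
  exists t : Sing n E, (qmap \o t : Sing n M) = s.
Proof.
have [_ q_surj _] := deck_covering qA.
have [e _ qe] := q_surj (s (vertex R n)) Logic.I.
have [g [cg qg _]] := lift_contractible (deck_covering qA) (@shrink_cont R n)
  (@shrink0 R n) (@shrink1 R n) (@shrink_vertex R n) (@cts_fun _ _ s) qe.
by exists (mkcts cg); apply/continuousEP.
Qed.

Lemma simplex_deck n (s t : Sing n E) :
  (qmap \o s : Sing n M) = (qmap \o t : Sing n M) ->
  exists a, t = (amap a \o s : Sing n E).
Proof.
move=> /continuousEP st; have [a ae] := deck_fibre qA (st (vertex R n)).
exists a; apply/continuousEP => u; apply/esym; move: u.
apply: (lift_unique_tracks (deck_covering qA) (@shrink_cont R n) (@shrink0 R n)
  (@shrink1 R n)).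
- exact: cts_fun.
- exact: cts_fun.
- by move=> u; exact: etrans (deck_over qA a (s u)) (st u).
- exact: ae.
Qed.

Variable n : nat.

(** The boundary of a lift [B] of [b0] lies over [c] and differs from a
    lift of [c] taken simplex by simplex by differences of translated
    simplices. The finitely many translations that occur are those to
    which [quasi_section] is applied, with [eps] so small that [2 * eps]
    times the norm of the boundary of [B] is at most 1. *)
Lemma filled_covering (c : chain R n M) (b0 : chain R n.+1 M) (k : nat) :
  boundary b0 = c ->
  exists (T : topologicalType) (p : continuousType T M) (d : nat)
         (b : chain R n.+1 T),
    [/\ regular_covering p /\ covering_degree p d,
        infinite_set [set: G] -> path_connected R T, (k <= d)%N &
        boundary b = full_lift p c /\
        (l1norm b)%:~R <= d%:R * 2 * (l1norm c)%:~R :> R].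
Proof.
move=> b0c.
have [l lP] := boolp.choice (@ex_simplex_lift n).
have [l' l'P] := boolp.choice (@ex_simplex_lift n.+1).
pose lift_chain : chain R n M -> chain R n E := fglift (fun s => << l s >>).
pose B : chain R n.+1 E := fglift (fun s => << l' s >>) b0.
have q_ctil : push qmap (boundary B) = c.
  rewrite -boundary_push /push fglift_comp -[RHS]b0c; congr boundary.
  rewrite -[RHS]fglift_id; apply: fglift_eq => s.
  by rewrite fglift1 l'P.
have ex_h (s : Sing n E) : exists a,
    l (qmap \o s : Sing n M) = (amap a \o s : Sing n E).
  by apply: simplex_deck; rewrite lP.
have [h hP] := boolp.choice ex_h.
have lE : lift_chain c = fglift (fun s : Sing n E =>
    << (amap (h s) \o s : Sing n E) >>) (boundary B).
  rewrite -q_ctil /lift_chain fglift_comp; apply: fglift_eq => s.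
  by rewrite fglift1 hP.
pose N : R := (fgl1 (boundary B))%:~R.
have N0 : 0 <= N by rewrite ler0z fgl1_ge0.
have eps0 : 0 < (2 * (N + 1))^-1 by rewrite invr_gt0; lra.
pose S := [seq h s | s <- dom (boundary B)].
have [Q [phi [f [phiM surj kQ bad]]]] := quasi_section S k G_amenable G_rf eps0.
have [x [H [H_cont H0 H1]]] := E_contractible.
pose W m := @filling _ _ _ _ _ qA Q phi R H H_cont f m.
have W_diff : (fgl1 (W n (boundary B - lift_chain c)))%:~R <= #|Q|%:R :> R.
  have -> : boundary B - lift_chain c = fglift (fun s : Sing n E =>
      << s >> - << (amap (h s) \o s : Sing n E) >>) (boundary B).
    rewrite lE -{1}[boundary B]fglift_id !fgliftE -sumrB.
    by apply: eq_bigr => s _; rewrite scalerBr.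
  rewrite /W filling_fglift fgliftE.
  apply: (@le_trans _ _ (\sum_(s <- dom (boundary B))
      (`|coeff s (boundary B)| : int)%:~R * ((N + 1)^-1 * #|Q|%:R))).
    apply: (@le_trans _ _ (\sum_(s <- dom (boundary B))
        `|coeff s (boundary B)| *
        fgl1 (W n (<< s >> - << (amap (h s) \o s : Sing n E) >>)))%:~R).
      rewrite ler_int; apply: le_trans (fgl1_sum _ _ _) _.
      by apply: ler_sum => s _; rewrite fgl1Z.
    rewrite rmorph_sum /= big_seq [leRHS]big_seq; apply: ler_sum => s sB.
    rewrite rmorphM /= ler_wpM2l ?ler0z //.
    have := bad (h s) (map_f _ sB); set m := #|_| => mbad.
    apply: (@le_trans _ _ ((2 * m%:R : int)%:~R)).
      by rewrite ler_int; exact: fgl1_filling_diff.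
    rewrite rmorphM /= !rmorph_nat.
    by rewrite invfM -mulrA in mbad; lra.
  rewrite -mulr_suml -[X in X * _]rmorph_sum /= -/(fgl1 (boundary B)) -/N mulrA.
  rewrite -[leRHS]mul1r ler_wpM2r // ler_pdivrMr ?mul1r; lra.
pose b := W n (boundary B).
exists (assoc qA phi), (covering_map qA phi), #|Q|, (if c == 0 then 0 else b).
split=> //.
- by split; [exact: assoc_regular|exact: assoc_degree].
- by move=> /surj phi_surj; exact: assoc_path_connected.
- have [c0|c0] := eqVneq c 0.
    split; first by rewrite c0 [LHS]fglift0 [RHS]fglift0.
    by rewrite c0 [l1norm _]fgl1_0 [l1norm _]fgl1_0 mulr0.
  split.
    rewrite /b (boundary_filling qA phiM H_cont H0 H1) -q_ctil.
    by rewrite full_lift_push.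
have c1 : 1 <= (fgl1 c)%:~R :> R.
  rewrite -[1]/(1%:~R) ler_int -gtz0_ge1 lt_neqAle fgl1_ge0 andbT eq_sym.
  by apply: contra c0 => /eqP h0; rewrite -fgl1_eq0 h0.
have bE : b = W n (lift_chain c) + W n (boundary B - lift_chain c).
  by rewrite /W fillingB addrC subrK.
have lc : fgl1 (lift_chain c) <= fgl1 c.
  by rewrite -[leRHS]mul1r; apply: fgl1_fglift => s; rewrite fgl1U.
have : (fgl1 b)%:~R <= (fgl1 (W n (lift_chain c)))%:~R + #|Q|%:R :> R.
  apply: (@le_trans _ _ (fgl1 (W n (lift_chain c)) +
                         fgl1 (W n (boundary B - lift_chain c)))%:~R).
    by rewrite ler_int bE fgl1D.
  by rewrite rmorphD /= lerD2l.
move=> h1; apply: (le_trans h1).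
have h2 : (fgl1 (W n (lift_chain c)))%:~R <= #|Q|%:R * (fgl1 c)%:~R :> R.
  have -> : #|Q|%:R * (fgl1 c)%:~R = (#|Q|%:R * fgl1 c : int)%:~R :> R.
    by rewrite rmorphM /= rmorph_nat.
  rewrite ler_int; apply: le_trans (fgl1_filling _ _ _ _ _) _.
  by rewrite ler_wpM2l.
have h3 : #|Q|%:R <= #|Q|%:R * (fgl1 c)%:~R :> R by rewrite ler_peMr.
rewrite -/(fgl1 c) mulrAC mulrC mulr2n mulrDl mul1r; exact: lerD.
Qed.

End UniformBoundary.

(* No connected covering space has degree larger than the order of a finite
   fundamental group, so connectedness of the M_k is asserted only when the
   fundamental group is infinite. *)
Theorem theorem1p2 (R : realType) (M : topologicalType) (x0 : M)
    (M_aspherical : aspherical R M)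
    (pi1_countable : countable [set: pi1 R x0])
    (pi1_amenable : amenable R (pi1 R x0))
    (pi1_residually_finite : residually_finite (pi1 R x0))
    (n : nat) :
  exists2 K : R, 0 < K &
  forall c : chain R n M, is_cycle c -> null_homologous c ->
  exists (Mk : nat -> topologicalType)
         (p : forall k, continuousType (Mk k) M)
         (d : nat -> nat)
         (b : forall k, chain R n.+1 (Mk k)),
  [/\ forall k, regular_covering (p k) /\ covering_degree (p k) (d k),
      infinite_set [set: pi1 R x0] -> forall k, path_connected R (Mk k),
      d @ \oo --> \oo &
      forall k, boundary (b k) = full_lift (p k) c /\
        (l1norm (b k))%:~R <= (d k)%:R * K * (l1norm c)%:~R].
Proof.
have [_ M_lpc [E [q [q_cov E_sc E_contr]]]] := M_aspherical.
have [e0 _ qe0] : (q @` setT) x0 by have [_ q_surj _] := q_cov; exact: q_surj.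
case: _ / qe0 pi1_countable pi1_amenable pi1_residually_finite => _ am rf.
pose act := @deck R E M q e0 q_cov E_sc.
have qA : deck_action q act.
  split=> //.
  - by move=> a; exact: deck_continuous.
  - exact: q_deck.
  - exact: deckM.
  - exact: deck1.
  - exact: deck_free.
  - exact: deck_trans.
exists 2 => // c _ [b0 b0c].
have fill k := filled_covering qA E_contr E_sc.1 am rf k b0c.
pose T := {T : topologicalType &
  {p : continuousType T M & (nat * chain R n.+1 T)%type}}.
have ex_T k : exists t : T, [/\ regular_covering (projT1 (projT2 t)) /\
      covering_degree (projT1 (projT2 t)) (projT2 (projT2 t)).1,
    infinite_set [set: pi1 R (q e0)] -> path_connected R (projT1 t),
    (k <= (projT2 (projT2 t)).1)%N &
    boundary (projT2 (projT2 t)).2 = full_lift (projT1 (projT2 t)) c /\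
    (l1norm (projT2 (projT2 t)).2)%:~R <=
      (projT2 (projT2 t)).1%:R * 2 * (l1norm c)%:~R :> R].
  have [X [p [d [b h]]]] := fill k.
  by exists (existT _ X (existT _ p (d, b))).
have [t tP] := boolp.choice ex_T.
exists (fun k => projT1 (t k)), (fun k => projT1 (projT2 (t k))),
  (fun k => (projT2 (projT2 (t k))).1), (fun k => (projT2 (projT2 (t k))).2).
split.
- by move=> k; have [] := tP k.
- by move=> inf k; have [_ /(_ inf)] := tP k.
- apply/cvgnyPge => N; exists N => // k /= Nk.
  by have [_ _ kd _] := tP k; exact: leq_trans Nk kd.
- by move=> k; have [] := tP k.
Qed.
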